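(* Let $(S,M)$ be a marked surface, $T$ a tagged triangulation satisfying (A1), and $\delta$ a tagged arc with $\overline\delta\notin T$ satisfying (A2). For every perfect matching $E$ of the bipartite graph $B_\delta$ associated with $T_\delta$, one has $I(E)=Y(\varpi^{-1}(E))$ as sets of diagonals of $T_\delta$.
   Context: Surface setting. A marked surface $(S,M)$: $S$ is a connected compact oriented Riemann surface with possibly empty boundary, $M\subset S$ a non-empty finite set with at least one point on each boundary component; punctures are the points of $M$ in the interior. Excluded: a monogon with at most one puncture, an unpunctured digon or triangle, a sphere with at most three punctures. Arcs, ideal triangulations, tagged arcs and tagged triangulations are in the sense of Fomin–Shapiro–Thurston; if $S$ is closed with exactly one puncture, all tagged arcs are plain. $\overline\delta$ is the plain arc underlying $\delta$; for a plain arc $\gamma$ with endpoints $p,q$, $\gamma^{(p)}$ is $\gamma$ notched at $p$ and $\gamma^{(pq)}$ is $\gamma$ notched at both ends. (A1) $T$ consists of plain and 1-notched arcs, and for each puncture at most one 1-notched arc of $T$ has its notched end there. (A2) No 1-notched arc of $T$ has its notched end at a puncture where $\delta$ is notched. $T^0$ is the ideal triangulation obtained from $T$ by replacing every 1-notched arc (plain at $o$, notched at $r$) by the loop at $o$ around it cutting out a monogon containing only the puncture $r$. Polygon $T_\delta$. Let $\gamma=\overline\delta$, oriented from $q$ to $p$; $\tau_1,\dots,\tau_n$ the arcs of $T^0$ crossed by $\gamma$ in order, $\triangle_0,\dots,\triangle_n$ the triangles passed through. $T_\gamma$ is the triangulated $(n+3)$-gon obtained from copies of $\triangle_0,\dots,\triangle_n$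 (a self-folded triangle is cut open along its radius) by gluing the copies of $\triangle_{i-1},\triangle_i$ along $\tau_i$. $T_{\gamma^{(p)}}$ is obtained from $T_\gamma$ by gluing on copies of triangles, one for each corner at $p$ of a triangle of $T^0$ other than the corner through which $\gamma$ reaches $p$, cyclically around $p$ as in the surface, so that $p$ becomes an interior vertex (puncture) of a triangulated polygon; $T_{\gamma^{(pq)}}$: the same at both ends. Gluing edges are diagonals, other edges boundary segments. $\zeta_1,\dots,\zeta_m$ (resp. $\xi_1,\dots,\xi_\ell$) are the diagonals of $T_\delta$ at the puncture $p$ (resp. $q$), counterclockwise around it, with $\tau_n,\zeta_1,\zeta_m$ (resp. $\tau_1,\xi_1,\xi_\ell$) in one triangle. A perfect matching of angles in $T_\delta$ is a set of angles of its triangles containing exactly one angle at each vertex incident to at least one diagonal and exactly one angle of each triangle; $\mathbb{A}(T_\delta)$ is the set of these. The minimal matching $A_-(T_\delta)\in\mathbb{A}(T_\delta)$ is the unique one such that at each boundary vertex $v$ incident to a diagonal its angle at $v$ comes first in counterclockwise order around $v$. An exterior angle is an angle between a boundary segment and a diagonal. For $A\in\mathbb{A}(T_\delta)$, $Y'(A)$ is the set of diagonals that are sides of at least one exterior angle in $A_-(T_\delta)\triangle A$ (symmetric difference). $Y(A)=Y'(A)\sqcup\{\tau_1\}$ if $\delta=\gamma^{(pq)}$, $n=1$ and $A$ contains at least one of the four angles between ($\zeta_m$ or $\xi_\ell$) and ($\tau_1$ or a boundary segment); otherwise $Y(A)=Y'(A)$. $B_\delta$: black vertices are the vertices of $T_\delta$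 incident to at least one diagonal, white vertices are the triangles of $T_\delta$; each triangle is joined to those of its vertices that are black. $B_\delta$ is drawn in the plane inside $T_\delta$. $\varpi$ sends the angle at a black vertex $v$ in a triangle $\triangle$ to the edge $v\triangle$; it induces a bijection from $\mathbb{A}(T_\delta)$ to perfect matchings of $B_\delta$. $E_-(B_\delta):=\varpi(A_-(T_\delta))$. For each diagonal $\tau$ the square labelled $\tau$ is the 4-cycle face of $B_\delta$ with white vertices the two triangles containing $\tau$ and black vertices the endpoints of $\tau$. For a perfect matching $E$ of $B_\delta$, $E_-(B_\delta)\triangle E$ consists of all boundary edges of a subgraph $B_E$ that is a union of squares (a boundary edge being an edge lying in exactly one of these squares), and $I(E)$ is the set of (labels of) squares contained in $B_E$. *)

(* Defs.v *)
From mathcomp Require Import all_boot all_order all_algebra.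

Set Implicit Arguments.
Unset Strict Implicit.
Unset Printing Implicit Defensive.

Import Order.TTheory GRing.Theory Num.Theory.
Local Open Scope ring_scope.

(* The corners of a triangle [t] are [(t, 0)], [(t, 1)], [(t, 2)] in
   counterclockwise order.  The side [(t, i)] is directed from the corner
   [(t, i)] to the corner [(t, i + 1)], with the triangle on its left.
   [glued s s'] means that the sides [s] and [s'] are identified, always
   reversing their directions, so that the result is oriented.  A
   self-folded triangle has two of its own sides glued to each other.
   A corner [(t, i)] is also the angle of [t] at that corner. *)
Record gluing := Gluing { tri : finType; glued : rel (tri * 'Z_3) }.

Notation side G := (tri G * 'Z_3)%type.
Notation corner G := (tri G * 'Z_3)%type.

Section Gluings.
Variable G : gluing.
Implicit Types (c s : corner G) (t : tri G).

Definition next c : corner G := (c.1, c.2 + 1).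
Definition prev c : corner G := (c.1, c.2 - 1).

(* The two sides at the corner [c] are [c] and [prev c]; the angle [c] is
   swept counterclockwise from the side [c] to the side [prev c]. *)
Definition at_corner (c s : corner G) : bool := (s == c) || (s == prev c).

Definition inner s : bool := [exists s' : side G, glued s s'].
Definition boundary s : bool := ~~ inner s.

Definition edge s : {set side G} := s |: [set s' | glued s s'].
Definition edges : {set {set side G}} := [set edge s | s : side G].
Definition diagonals : {set {set side G}} := [set edge s | s : side G & inner s].

(* [c'] is the angle following [c] counterclockwise around their vertex. *)
Definition ccw : rel (corner G) := fun c c' => glued (prev c) c'.

(* A vertex is encoded by the set of all corners located at it. *)
Definition vertex c : {set corner G} :=
  [set c' | connect (fun a b => ccw a b || ccw b a) c c'].
Definition vertices : {set {set corner G}} := [set vertex c | c : corner G].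

Definition puncture (v : {set corner G}) : bool :=
  (v \in vertices) && [forall c in v, inner c && inner (prev c)].
Definition boundary_vertex (v : {set corner G}) : bool :=
  (v \in vertices) && ~~ puncture v.

End Gluings.

Definition disk (G : gluing) : bool :=
  (#|vertices G| + #|tri G| == (#|edges G|).+1)%N.
Definition sphere (G : gluing) : bool :=
  (#|vertices G| + #|tri G| == (#|edges G|).+2)%N.

Definition num_punctures (G : gluing) : nat :=
  #|[set v in vertices G | puncture v]|.
Definition num_boundary_points (G : gluing) : nat :=
  #|[set v in vertices G | boundary_vertex v]|.

Definition excluded_surface (G : gluing) : bool :=
  [|| [&& disk G, num_boundary_points G == 1%N & (num_punctures G <= 1)%N],
      [&& disk G, num_boundary_points G == 2%N & num_punctures G == 0%N],
      [&& disk G, num_boundary_points G == 3%N & num_punctures G == 0%N]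
    | sphere G && (num_punctures G <= 3)%N].

Definition closed_once_punctured (G : gluing) : bool :=
  [forall s : side G, inner s] && (num_punctures G == 1%N).

(* A marked surface (S, M) together with an ideal triangulation T^0 (possibly
   with self-folded triangles): S is glued from the triangles of T^0, M is the
   set of vertices, and the arcs of T^0 are the [diagonals].  For connected
   surfaces Euler characteristic 1 (resp. 2) characterizes disks (resp.
   spheres). *)
Record triangulated_marked_surface (G : gluing) : Prop := {
  glued_sym : symmetric (@glued G);
  glued_irr : irreflexive (@glued G);
  glued_fun : forall s s1 s2 : side G, glued s s1 -> glued s s2 -> s1 = s2;
  glued_connected : forall t t' : tri G,
    connect (fun a b => [exists i, exists j, glued (a, i) (b, j)]) t t';
  glued_not_excluded : ~~ excluded_surface G
}.

Section Tagged.
Variable S : gluing.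

(* The corner [c] is the angle of a self-folded triangle at its enclosed
   puncture; the radius is [edge c] and the enclosing loop [edge (next c)]. *)
Definition enclosed (c : corner S) : bool := ccw c c.
Definition enclosing_loop (e : {set side S}) : bool :=
  [exists c : corner S, enclosed c && (e == edge (next c))].

(* The two ends of an arc [e = [set s; s']] are the starting points of [s] and
   of [s'].  A tagged arc is a pair [(e, N)] of an arc and of the subset [N] of
   those [s] in [e] such that it is notched at the starting point of [s]. *)
Definition tagged_edge := ({set side S} * {set side S})%type.

Definition plain (a : tagged_edge) : bool := #|a.2| == 0%N.
Definition one_notched (a : tagged_edge) : bool := #|a.2| == 1%N.
Definition notched_at (a : tagged_edge) (v : {set corner S}) : bool :=
  [exists s in a.2, vertex s == v].

(* The tagged triangulation T encoded by the ideal triangulation underlying [S]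
   and by the set [N] of the punctures at which all the ends of arcs of T
   are notched (Fomin-Shapiro-Thurston).  At an enclosed puncture, T has the
   radius both plain and notched, the notched one replacing the loop. *)
Definition notched_ends (N : {set {set corner S}}) (e : {set side S}) :=
  [set s in e | (vertex s \in N) && ~~ enclosed s].

Definition tagged_arcs (N : {set {set corner S}}) : {set tagged_edge} :=
  [set (e, notched_ends N e) | e in diagonals S & ~~ enclosing_loop e]
  :|: [set (edge c, c |: notched_ends N (edge c)) | c : corner S & enclosed c].

Definition tagged_triangulation (N : {set {set corner S}}) : Prop :=
  (forall v, v \in N -> puncture v) /\ (closed_once_punctured S -> N = set0).

Definition A1 (T : {set tagged_edge}) : Prop :=
  (forall a, a \in T -> plain a || one_notched a) /\
  (forall v, puncture v ->
     (#|[set a in T | one_notched a && notched_at a v]| <= 1)%N).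

(* A plain arc not in T is encoded, up to isotopy, by the sequence of the
   n = k.+1 >= 1 arcs tau_1, ..., tau_n of T^0 that it crosses: the i-th entry
   is the pair of the side of triangle_(i-1) through which the arc leaves this
   triangle and of the side of triangle_i, glued to it, through which it
   enters the latter.  The arc starts at the corner of triangle_0 opposite to
   tau_1 and ends at the corner of triangle_n opposite to tau_n. *)
Section Curve.
Variables (k : nat) (gamma : k.+1.-tuple (side S * side S)).

Definition leave (i : 'I_k.+1) : side S := (tnth gamma i).1.
Definition enter (i : 'I_k.+1) : side S := (tnth gamma i).2.

Definition opposite (s : side S) : corner S := prev s.

Definition start_corner : corner S := opposite (leave ord0).
Definition end_corner : corner S := opposite (enter ord_max).

Definition reduced_curve : Prop :=
  (forall i, glued (leave i) (enter i)) /\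
  sorted (fun a b => (a.2.1 == b.1.1) && (a.2 != b.1)) gamma.

(* A representative of the isotopy class which is straight in each triangle
   crosses tau_(i+1) at the point with parameter [x i] along [leave i], which
   has parameter [1 - x i] along [enter i].  On the boundary of a triangle, the
   point with parameter y on the i-th side has coordinate i + y. *)
Definition segment_tri (j : 'I_k.+2) : tri S :=
  if unlift ord_max j is Some i then (leave i).1 else end_corner.1.
Definition segment_from (x : 'I_k.+1 -> rat) (j : 'I_k.+2) : rat :=
  if unlift ord0 j is Some i then (enter i).2%:R + (1 - x i)
  else start_corner.2%:R.
Definition segment_to (x : 'I_k.+1 -> rat) (j : 'I_k.+2) : rat :=
  if unlift ord_max j is Some i then (leave i).2%:R + x i
  else end_corner.2%:R.

Definition separates (a b c : rat) : bool := Num.min a b < c < Num.max a b.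
Definition chords_cross (a b c d : rat) : bool :=
  uniq [:: a; b; c; d] && (separates a b c != separates a b d).

Definition simple_curve : Prop :=
  exists x : 'I_k.+1 -> rat,
    [/\ forall i, 0 < x i < 1,
        forall i j, i != j ->
          (leave i, x i) <> (leave j, x j) /\
          (leave i, x i) <> (enter j, 1 - x j)
      & forall i j, i != j -> segment_tri i = segment_tri j ->
          ~~ chords_cross (segment_from x i) (segment_to x i)
                          (segment_from x j) (segment_to x j)].

End Curve.

Definition reverse_curve (w : seq (side S * side S)) :=
  [seq (e.2, e.1) | e <- rev w].

(* The crossings [f] turn counterclockwise around a vertex, starting in its
   corner [c]. *)
Fixpoint turns_around (c : corner S) (f : seq (side S * side S)) : bool :=
  if f is e :: f' then (e.1 == prev c) && turns_around e.2 f' else true.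

(* The loop follows an arc [u], ending at the puncture with corner [c], turns
   around this puncture and comes back along [u].  If [u] is empty, the arc
   followed is in T^0 and is not crossed. *)
Definition encircles_ccw (w : seq (side S * side S)) : Prop :=
  exists (u f : seq (side S * side S)) (c : corner S),
    [/\ puncture (vertex c), turns_around c f, w = u ++ f ++ reverse_curve u
      & if u is e :: u' then
          size f = #|vertex c| /\ c = opposite (last e u').2
        else (size f).+1 = #|vertex c|].

Definition cuts_out_once_punctured_monogon (w : seq (side S * side S)) : Prop :=
  encircles_ccw w \/ encircles_ccw (reverse_curve w).

(* [nq] and [np] tell whether the arc is notched at its starting point q and
   at its ending point p. *)
Definition tagged_arc k (gamma : k.+1.-tuple (side S * side S))
    (nq np : bool) : Prop :=
  let q := vertex (start_corner gamma) in
  let p := vertex (end_corner gamma) in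
  [/\ reduced_curve gamma, simple_curve gamma
    & ~ cuts_out_once_punctured_monogon gamma] /\
  [/\ nq -> puncture q, np -> puncture p, q = p -> nq = np
    & closed_once_punctured S -> ~~ nq /\ ~~ np].

Definition A2 (T : {set tagged_edge}) k (gamma : k.+1.-tuple (side S * side S))
    (nq np : bool) : Prop :=
  forall a, a \in T -> one_notched a ->
    (nq -> ~~ notched_at a (vertex (start_corner gamma))) /\
    (np -> ~~ notched_at a (vertex (end_corner gamma))).

Section Polygon.
Variables (k : nat) (gamma : k.+1.-tuple (side S * side S)) (nq np : bool).

(* The fan glued on at the puncture containing the corner [c0] when [b] holds
   has one triangle for each other corner at this puncture. *)
Definition fan (b : bool) (c0 : corner S) : finType :=
  {c : corner S | [&& b, c \in vertex c0 & c != c0]}.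

Definition polygon_tri : finType :=
  ('I_k.+2 + fan nq (start_corner gamma) + fan np (end_corner gamma))%type.

Definition strip (i : 'I_k.+2) : polygon_tri := inl (inl i).

(* The copy, around q (resp. p), of the triangle with corner [c] at q
   (resp. p). *)
Definition around_q (c : corner S) : polygon_tri :=
  if insub c is Some u then inl (inr u) else strip ord0.
Definition around_p (c : corner S) : polygon_tri :=
  if insub c is Some u then inr u else strip ord_max.

Definition seam (s s' : polygon_tri * 'Z_3) : bool :=
  [|| [exists i : 'I_k.+1,
         (s == (strip (lift ord_max i), (leave gamma i).2)) &&
         (s' == (strip (lift ord0 i), (enter gamma i).2))],
      nq && [exists c in vertex (start_corner gamma), exists c', [&& ccw c c',
         s == (around_q c, (prev c).2) & s' == (around_q c', c'.2)]]
    | np && [exists c in vertex (end_corner gamma), exists c', [&& ccw c c',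
         s == (around_p c, (prev c).2) & s' == (around_p c', c'.2)]]].

Definition polygon : gluing :=
  @Gluing polygon_tri (fun s s' => seam s s' || seam s' s).

Definition tau1 : {set side polygon} :=
  @edge polygon (strip ord0, (leave gamma ord0).2).

(* zeta_m (resp. xi_l) is the side from which, counterclockwise around the
   puncture, the angle of triangle_n at p (resp. of triangle_0 at q) starts. *)
Definition zeta_last : {set side polygon} :=
  @edge polygon (strip ord_max, (end_corner gamma).2).
Definition xi_last : {set side polygon} :=
  @edge polygon (strip ord0, (start_corner gamma).2).

End Polygon.
End Tagged.

Definition symdiff (X : finType) (A B : {set X}) : {set X} :=
  (A :\: B) :|: (B :\: A).

Section Matchings.
Variable P : gluing.
Implicit Types (A : {set corner P}) (d : {set side P}).

Definition black : {set {set corner P}} :=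
  [set v in vertices P | [exists c in v, inner c || inner (prev c)]].

Definition angle_matching A : bool :=
  [forall v in black, #|A :&: v| == 1%N] &&
  [forall t : tri P, #|[set c in A | c.1 == t]| == 1%N].

(* No angle precedes [c] counterclockwise around its vertex. *)
Definition first_angle (c : corner P) : bool :=
  [forall c' : corner P, ~~ ccw c' c].

Definition is_minimal A : bool :=
  angle_matching A &&
  [forall v in black, boundary_vertex v ==>
     [forall c in A :&: v, first_angle c]].

Definition minimal_matching : {set corner P} :=
  odflt set0 [pick A | is_minimal A].

Definition exterior (c : corner P) : bool := boundary c (+) boundary (prev c).

Definition Y' A : {set {set side P}} :=
  [set d in diagonals P |
    [exists c in symdiff minimal_matching A,
       exterior c && [exists s in d, at_corner c s]]].

(* An edge joins a black vertex to a white vertex, that is, to a triangle. *)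
Definition graph_edge := ({set corner P} * tri P)%type.
Implicit Types (E : {set graph_edge}).

Definition graph_edges : {set graph_edge} :=
  [set e | (e.1 \in black) && [exists c in e.1, c.1 == e.2]].

Definition perfect_matching E : bool :=
  [&& E \subset graph_edges,
      [forall v in black, #|[set e in E | e.1 == v]| == 1%N]
    & [forall t : tri P, #|[set e in E | e.2 == t]| == 1%N]].

Definition varpi (c : corner P) : graph_edge := (vertex c, c.1).

Definition varpi_inv E : {set corner P} :=
  [set c | (vertex c \in black) && (varpi c \in E)].

Definition minimal_perfect_matching : {set graph_edge} :=
  [set varpi c | c in minimal_matching].

(* The endpoints of the diagonal [d] are the starting points of its two
   sides. *)
Definition square d : {set graph_edge} :=
  [set e in graph_edges |
    [exists s in d, e.1 == vertex s] && [exists s in d, e.2 == s.1]].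

Definition boundary_edges (X : {set {set side P}}) : {set graph_edge} :=
  [set e | #|[set d in X | e \in square d]| == 1%N].

(* As the squares are bounded faces of a plane graph, at most one set of
   squares has a given set of boundary edges. *)
Definition bounded_squares E : {set {set side P}} :=
  odflt set0 [pick X : {set {set side P}} | (X \subset diagonals P) &&
    (boundary_edges X == symdiff minimal_perfect_matching E)].

(* The subgraph B_E, given by its edges. *)
Definition B_ E : {set graph_edge} := \bigcup_(d in bounded_squares E) square d.

Definition I_ E : {set {set side P}} :=
  [set d in diagonals P | square d \subset B_ E].

End Matchings.

Section Y.
Variables (S : gluing) (k : nat) (gamma : k.+1.-tuple (side S * side S)).
Variables (nq np : bool).
Let P := polygon gamma nq np.

Definition special_angle (c : corner P) : bool :=
  let last_side (s : side P) :=
    (edge s == zeta_last gamma nq np) || (edge s == xi_last gamma nq np) in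
  let tau1_or_boundary (s : side P) :=
    (edge s == tau1 gamma nq np) || boundary s in
  (last_side c && tau1_or_boundary (prev c)) ||
  (last_side (prev c) && tau1_or_boundary c).

(* Here n = 1 reads k = 0. *)
Definition Y (A : {set corner P}) : {set {set side P}} :=
  if [&& nq, np, k == 0%N & [exists c in A, special_angle c]]
  then tau1 gamma nq np |: Y' A
  else Y' A.

End Y.

(* Main.v *)
(* Let D be the symmetric difference of the minimal matching and of the
   matching A corresponding to E.  Each angle c lies between two sides, and the
   edge of B at c lies in the squares of those of the two sides that are
   diagonals; so a set X of diagonals has D as boundary iff D c = X c + X c'
   (mod 2) whenever c, c' are the sides at the angle c.  As D is even at every
   vertex and on every triangle and the polygon is simply connected, D has such
   a potential, constant and hence normalized to zero on the boundary.  At an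
   exterior angle this reads: the diagonal d is in X iff the angle is in D, so
   that X and Y' agree on the diagonals having an exterior angle.  The only
   other possible diagonal is tau_1, for n = 1 and both ends notched.  At either
   endpoint of tau_1 the last two angles f, f' are special, and neither is in
   the minimal matching; hence tau_1 is in X iff A contains f or f'. *)

Require Import Defs.
From mathcomp Require Import all_boot all_order all_algebra.

Set Implicit Arguments.
Unset Strict Implicit.
Unset Printing Implicit Defensive.

Import GRing.Theory.
Local Open Scope ring_scope.

(* [path] also defines [next] and [prev]. *)
Notation next := Defs.next.
Notation prev := Defs.prev.

(** Simple connectivity enters as explicit integration. A potential exists on each triangle up to a
    constant; the constants are adjusted along the strip, which is a path of triangles, and around
    each fan, where evenness of D at the puncture is exactly the closing condition. Passing between
    angles and edges of B requires the three corners of a triangle to lie at distinct vertices. This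
    would fail at a notched end enclosed by a self-folded triangle, where the fan is empty; (A1) and
    (A2) exclude that case. The minimal matching and the set of squares are both chosen by [pick]
    with a default value, so existence has to be proved for each. Finally, [I_ E] consists of the
    diagonals whose squares are covered by B_E. An exterior angle gives an edge lying in a single
    square, so that covered implies chosen; for the exceptional tau_1 all four edges are shared with
    other squares, and the matching property has to be used instead. *)

Lemma Z3_cases (x z : 'Z_3) : [\/ z = x, z = x + 1 | z = x - 1].
Proof.
by case: x z => [[|[|[|//]]] ?] [[|[|[|//]]] ?];
  first [apply: Or31; exact: val_inj | apply: Or32; exact: val_inj
        | apply: Or33; exact: val_inj].
Qed.

Lemma Z3_addr1_neq (x : 'Z_3) : (x + 1 == x) = false.
Proof. by case: x => [[|[|[|//]]] ?]. Qed.

Lemma Z3_subr1_neq (x : 'Z_3) : (x - 1 == x) = false.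
Proof. by case: x => [[|[|[|//]]] ?]. Qed.

Lemma Z3_addr1_subr1_neq (x : 'Z_3) : (x + 1 == x - 1) = false.
Proof. by case: x => [[|[|[|//]]] ?]. Qed.

Lemma Z3_addr11 (x : 'Z_3) : x + 1 + 1 = x - 1.
Proof. by apply: val_inj; case: x => [[|[|[|//]]] ?]. Qed.

Lemma Z3_subr11 (x : 'Z_3) : x - 1 - 1 = x + 1.
Proof. by apply: val_inj; case: x => [[|[|[|//]]] ?]. Qed.

Lemma big_Z3 (R : Type) (idx : R) (op : Monoid.com_law idx) (F : 'Z_3 -> R) x :
  \big[op/idx]_(z : 'Z_3) F z = op (op (F x) (F (x + 1))) (F (x - 1)).
Proof.
rewrite (bigD1 x) //= (bigD1 (x + 1)) /= ?Z3_addr1_neq //.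
rewrite (big_pred1 (x - 1)) ?Monoid.mulmA // => z /=.
by case: x z => [[|[|[|//]]] ?] [[|[|[|//]]] ?].
Qed.

(** * Gluings of triangles *)

Section Gluing.
Variable G : gluing.
Hypothesis glueC : symmetric (@glued G).
Hypothesis glue_inj : forall s s1 s2 : side G,
  glued s s1 -> glued s s2 -> s1 = s2.
Implicit Types (c s : corner G) (t : tri G) (v : {set corner G}).

Lemma nextK : cancel (@next G) (@prev G).
Proof. by case=> t z; rewrite /next /prev /= addrK. Qed.

Lemma prevK : cancel (@prev G) (@next G).
Proof. by case=> t z; rewrite /next /prev /= subrK. Qed.

Lemma next_next c : next (next c) = prev c.
Proof. by rewrite /next /prev /= Z3_addr11. Qed.

Lemma prev_prev c : prev (prev c) = next c.
Proof. by rewrite /next /prev /= Z3_subr11. Qed.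

Lemma corner_cases c s : s.1 = c.1 -> [\/ s = c, s = next c | s = prev c].
Proof.
case: c s => t z [t' z'] /= ->.
by case: (Z3_cases z z') => ->;
  [apply: Or31 | apply: Or32 | apply: Or33].
Qed.

(** The default value [s] at a boundary side makes [mate] a total involution, and hence [turn] an
    injection on all corners. *)
Definition mate s : side G := odflt s [pick s' | glued s s'].

Lemma mate_glued s s' : glued s s' -> mate s = s'.
Proof.
rewrite /mate; case: pickP => [s1 /= h1 h2|-> //]; exact: glue_inj h1 h2.
Qed.

Lemma glued_mate s : inner s -> glued s (mate s).
Proof. by case/existsP=> s' h; rewrite (mate_glued h). Qed.

Lemma mate_boundary s : boundary s -> mate s = s.
Proof.
by rewrite /mate; case: pickP => // s' /= h /existsP[]; exists s'.
Qed.

Lemma glued_inner s s' : glued s s' -> inner s.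
Proof. by move=> h; apply/existsP; exists s'. Qed.

Lemma glued_innerr s s' : glued s s' -> inner s'.
Proof. by rewrite glueC; exact: glued_inner. Qed.

Lemma inner_mate s : inner (mate s) = inner s.
Proof.
have [h|h] := boolP (inner s).
  exact: glued_innerr (glued_mate h).
by rewrite mate_boundary // (negbTE h).
Qed.

Lemma mateK : involutive mate.
Proof.
move=> s; have [h|h] := boolP (inner s); last by rewrite !mate_boundary.
by apply: mate_glued; rewrite glueC glued_mate.
Qed.

Definition turn c : corner G := mate (prev c).

Lemma turn_inj : injective turn.
Proof. by move=> c c' /(inv_inj mateK) /(can_inj prevK). Qed.

Lemma ccw_turn c c' : ccw c c' -> turn c = c'.
Proof. exact: mate_glued. Qed.

Lemma turn_ccw c : inner (prev c) -> ccw c (turn c).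
Proof. exact: glued_mate. Qed.

Lemma vertex_sym : connect_sym (fun a b : corner G => ccw a b || ccw b a).
Proof.
move=> a b; apply/idP/idP; rewrite connect_rev; apply: connect_sub => x y /=;
  by rewrite orbC => h; apply: connect1.
Qed.

Lemma in_vertex c c' : (c' \in vertex c) = (vertex c' == vertex c).
Proof.
apply/idP/eqP => [|<-]; last by rewrite inE connect0.
rewrite inE => h.
apply/setP=> x; rewrite !inE; symmetry.
exact: (same_connect vertex_sym h).
Qed.

Lemma vertex_refl c : c \in vertex c.
Proof. by rewrite in_vertex. Qed.

Lemma mem_vertices c : vertex c \in vertices G.
Proof. exact: imset_f. Qed.

Lemma vertexE c c' : c' \in vertex c -> vertex c' = vertex c.
Proof. by rewrite in_vertex => /eqP. Qed.

Lemma ccw_vertex c c' : ccw c c' -> vertex c' = vertex c.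
Proof. by move=> h; apply: vertexE; rewrite inE connect1 ?h. Qed.

Lemma glued_vertex s s' : glued s s' -> vertex s' = vertex (next s).
Proof. by move=> h; apply: ccw_vertex; rewrite /ccw nextK. Qed.

Lemma vertex_const (T : Type) (f : corner G -> T) c c' :
  (forall a b, ccw a b -> f a = f b) -> c' \in vertex c -> f c' = f c.
Proof.
rewrite inE => hf /connectP[p + ->]; elim: p c => //= a p ih c.
by case/andP=> /orP[] /hf h /ih ->.
Qed.

Lemma vertex_closed (Q : pred (corner G)) c c' :
  (forall a b, ccw a b -> Q a = Q b) -> c' \in vertex c -> Q c -> Q c'.
Proof. by move=> h /(vertex_const h) ->. Qed.

(** The corners reached from [c] by [ccw] are also closed under predecessors, because [turn] is
    injective and nothing precedes [c]. So they exhaust the vertex, and each of them except [c] has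
    an angle before it and starts at an inner side. *)
Lemma boundary_start_uniq c c' :
  boundary c -> boundary c' -> c' \in vertex c -> c' = c.
Proof.
move=> hc hc'.
pose R a := connect (@ccw G) c a.
have hR a b : ccw a b -> R a = R b.
  move=> hab; apply/idP/idP => [h|].
    exact: connect_trans h (connect1 hab).
  case/connectP=> p; case/lastP: p => [_ /= eb|p d].
    by move/negP: hc; rewrite -eb; case; exact: glued_innerr hab.
  rewrite rcons_path last_rcons => /andP[hp hd] ?; subst d.
  have := etrans (ccw_turn hab) (esym (ccw_turn hd)) => /turn_inj ->.
  by apply/connectP; exists p.
move=> h; have := vertex_closed hR h (connect0 _ _).
case/connectP=> p; case/lastP: p => [//|p d].
rewrite rcons_path last_rcons => /andP[hp hd] ?; subst d.
by move/negP: hc'; case; exact: glued_innerr hd.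
Qed.

Lemma boundary_end_uniq c c' :
  boundary (prev c) -> boundary (prev c') -> c' \in vertex c -> c' = c.
Proof.
move=> hc hc'.
pose R a := connect (@ccw G) a c.
have hR a b : ccw a b -> R a = R b.
  move=> hab; apply/idP/idP => [|h].
    case/connectP=> -[_ /= eb|d p /= /andP[hd hp] eb].
      by move/negP: hc; rewrite eb; case; exact: glued_inner hab.
    rewrite -(ccw_turn hab) (ccw_turn hd).
    by apply/connectP; exists p.
  exact: connect_trans (connect1 hab) h.
move=> h; have := vertex_closed hR h (connect0 _ _).
case/connectP=> -[//|d p /= /andP[hd hp] _].
by move/negP: hc'; case; exact: glued_inner hd.
Qed.

Lemma turn_bij_vertex (R : Type) (idx : R) (op : Monoid.com_law idx)
    (F : corner G -> R) v : v \in vertices G ->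
  \big[op/idx]_(c in v | inner c) F c =
  \big[op/idx]_(c in v | inner (prev c)) F (turn c).
Proof.
case/imsetP=> c0 _ ->; rewrite (reindex_inj turn_inj) /=.
apply: eq_bigl => c; rewrite inner_mate andbC [RHS]andbC.
have [h|//] := boolP (inner (prev c)).
by rewrite /= !in_vertex (ccw_vertex (turn_ccw h)).
Qed.

(** By counting: [turn] matches the corners of [v] that end at an inner side with those that start
    at one. If all start at inner sides, then all end at inner sides, and [v] is a puncture. *)
Lemma exists_boundary_start v : boundary_vertex v ->
  exists2 c, c \in v & boundary c.
Proof.
rewrite /boundary_vertex /puncture => /andP[hv]; rewrite hv /= => hn.
have [/exists_inP[c h1 h2]|/exists_inPn h] := boolP [exists c in v, boundary c].
  by exists c.
have := turn_bij_vertex addn (fun=> 1%N) hv; rewrite !sum1_card => e1.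
case/negP: hn; apply/forall_inP=> c hc.
have hin c' : c' \in v -> inner c' by move/h; rewrite negbK.
have e2 : [set c in v | inner (prev c)] = v.
  apply/eqP; rewrite eqEcard cardsE -e1; apply/andP; split.
    by apply/subsetP=> x; rewrite inE => /andP[].
  by apply: subset_leq_card; apply/subsetP=> x hx; rewrite unfold_in hx hin.
by rewrite hin //=; move: hc; rewrite -{1}e2 inE => /andP[].
Qed.

(* Summing [x c + x (prev c)] over a vertex leaves the two boundary sides. *)
Lemma xor_vertex (x : side G -> bool) v : v \in vertices G ->
  (forall s s', glued s s' -> x s = x s') ->
  \big[addb/false]_(c in v) (x c (+) x (prev c)) =
  (\big[addb/false]_(c in v | boundary c) x c) (+)
  (\big[addb/false]_(c in v | boundary (prev c)) x (prev c)).
Proof.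
move=> hv hx; rewrite big_split /=.
rewrite (bigID (@inner G)) /= [X in _ (+) X](bigID (fun c => inner (prev c))) /=.
have -> : \big[addb/false]_(c in v | inner c) x c =
    \big[addb/false]_(c in v | inner (prev c)) x (prev c).
  rewrite (turn_bij_vertex _ _ hv); apply: eq_bigr => c /andP[_ h].
  by rewrite -(hx _ _ (turn_ccw h)).
by rewrite addbACA addbb.
Qed.

(* As the boundary sides starting at a vertex number at most one, the sum has at
   most one term. *)
Definition boundary_value (x : side G -> bool) c :=
  \big[addb/false]_(c' in vertex c | boundary c') x c'.

Lemma boundary_value_ccw x c c' :
  ccw c c' -> boundary_value x c = boundary_value x c'.
Proof. by move/ccw_vertex=> h; rewrite /boundary_value h. Qed.

Lemma boundary_valueE x s : boundary s -> boundary_value x s = x s.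
Proof.
move=> hs; rewrite /boundary_value (big_pred1 s) // => c /=.
apply/andP/eqP => [[h1 h2]|->]; last by rewrite vertex_refl.
exact: boundary_start_uniq.
Qed.

(** Evenness at the end point of [s] forces the boundary side leaving this vertex to carry the same
    value as the boundary side [s] arriving there. *)
Lemma boundary_value_next (x : side G -> bool) s :
  (forall s s', glued s s' -> x s = x s') ->
  \big[addb/false]_(c in vertex (next s)) (x c (+) x (prev c)) = false ->
  boundary s -> boundary_value x (next s) = x s.
Proof.
move=> hx; rewrite xor_vertex ?imset_f // => /negbT + hs.
rewrite negb_add /boundary_value => /eqP ->.
rewrite (big_pred1 (next s)) ?nextK // => c /=.
apply/andP/eqP => [[h1 h2]|->]; last by rewrite vertex_refl nextK.
by apply: boundary_end_uniq h1 => //; rewrite nextK.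
Qed.

End Gluing.

Lemma xor_card (T : finType) (A : {set T}) (Q : pred T) :
  \big[addb/false]_(c | Q c) (c \in A) = odd #|[set c in A | Q c]|.
Proof.
rewrite -sum1_card (big_morph odd oddD (erefl : odd 0 = false)).
rewrite big_mkcond [RHS]big_mkcond; apply: eq_bigr => c _.
by rewrite inE andbC; case: (Q c) (c \in A) => [] [].
Qed.

(** * Squares and matchings *)

Section Squares.
Variable G : gluing.
Hypothesis glueC : symmetric (@glued G).
Hypothesis glue_inj : forall s s1 s2 : side G,
  glued s s1 -> glued s s2 -> s1 = s2.
Hypothesis vertex_inj_tri : forall c c' : corner G,
  c.1 = c'.1 -> vertex c = vertex c' -> c = c'.
Implicit Types (c s : corner G) (t : tri G) (v : {set corner G}).
Implicit Types (d : {set side G}) (X : {set {set side G}}).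
Implicit Types (A M : {set corner G}) (E : {set graph_edge G}).

Lemma in_edge s s' : (s' \in edge s) = (s' == s) || glued s s'.
Proof. by rewrite !inE. Qed.

Lemma edge_refl s : s \in edge s.
Proof. by rewrite in_edge eqxx. Qed.

Lemma edge_glued s s' : glued s s' -> edge s' = edge s.
Proof.
move=> h; apply/setP=> x; rewrite !in_edge; apply/orP/orP => -[].
- by move/eqP->; right.
- by move=> h'; left; apply/eqP; apply: glue_inj h' _; rewrite glueC.
- by move/eqP->; right; rewrite glueC.
- by move=> h'; left; apply/eqP; apply: glue_inj h' h.
Qed.

Lemma edgeE s s' : s' \in edge s -> edge s' = edge s.
Proof. by rewrite in_edge => /predU1P[->|/edge_glued]. Qed.

Lemma inner_edge s s' : edge s = edge s' -> inner s = inner s'.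
Proof.
move=> e; have := edge_refl s; rewrite e in_edge => /predU1P[-> //|h].
by rewrite (glued_inner h) (glued_innerr glueC h).
Qed.

Lemma mem_diagonals s : (edge s \in diagonals G) = inner s.
Proof.
apply/imsetP/idP => [[s' h e]|h]; last by exists s; rewrite ?inE.
by rewrite (inner_edge e); rewrite inE in h.
Qed.

Lemma diagonalP d : reflect (exists2 s, inner s & d = edge s)
  (d \in diagonals G).
Proof.
by apply: (iffP imsetP) => -[s h e]; exists s => //; move: h; rewrite ?inE.
Qed.

(** Gluing the two sides at [c] to each other would put the other two corners of the triangle at one
    vertex. *)
Lemma edge_prev_neq c : edge c != edge (prev c).
Proof.
apply/eqP=> e; have := edge_refl c; rewrite e in_edge => /orP[/eqP h|h].
  have := congr1 snd h => /= /eqP.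
  by rewrite eq_sym Z3_subr1_neq.
have h2 : ccw (next c) (prev c) by rewrite /ccw nextK glueC.
have := vertex_inj_tri _ (ccw_vertex h2) => /(_ erefl) /(congr1 snd) /= /eqP.
by rewrite eq_sym Z3_addr1_subr1_neq.
Qed.

Lemma in_black c : (vertex c \in black G) =
  [exists c' in vertex c, inner c' || inner (prev c')].
Proof. by rewrite inE mem_vertices. Qed.

Lemma black_corner c : inner c || inner (prev c) -> vertex c \in black G.
Proof.
by move=> h; rewrite in_black; apply/exists_inP; exists c; rewrite ?vertex_refl.
Qed.

Lemma black_vertex v c : v \in black G -> c \in v -> v = vertex c.
Proof. by rewrite inE => /andP[/imsetP[c' _ ->] _] /vertexE ->. Qed.

Lemma varpi_inj : injective (@varpi G).
Proof. by move=> c c' [h1 h2]; apply: vertex_inj_tri. Qed.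

Lemma varpi_graph_edge c : (varpi c \in graph_edges G) = (vertex c \in black G).
Proof.
rewrite inE /=; apply: andb_idr => _; apply/exists_inP.
by exists c => //; rewrite vertex_refl.
Qed.

Lemma graph_edgeP (e : graph_edge G) : e \in graph_edges G ->
  exists2 c, vertex c \in black G & e = varpi c.
Proof.
case: e => v t; rewrite inE /= => /andP[hv /exists_inP[c hc /eqP <-]].
by exists c; rewrite /varpi -(black_vertex hv hc).
Qed.

(** The triangle of [c] contains a side of [d], and the vertex of [c] is an end of [d]. By
    [vertex_inj_tri], [c] is then the start or the end of that side, which gives the two cases. *)
Lemma varpi_square c d : vertex c \in black G -> d \in diagonals G ->
  (varpi c \in square d) = (d == edge c) || (d == edge (prev c)).
Proof.
move=> hc hd; rewrite inE varpi_graph_edge hc /=; apply/andP/orP.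
  case/diagonalP: hd => s hs -> [/exists_inP[s1 h1 /eqP e1]].
  case/exists_inP=> s2 h2 /eqP e2.
  have E1 := edgeE h1; have E2 := edgeE h2.
  move: h2; rewrite -E1 in_edge => /predU1P[h2|h2].
    by left; rewrite (@vertex_inj_tri c s1) // -h2.
  right; rewrite E1 -E2 (@vertex_inj_tri c (next s2)) ?nextK //.
  by rewrite e1; apply: glued_vertex; rewrite glueC.
case=> /eqP e; rewrite {}e in hd *.
  by split; apply/exists_inP; exists c; rewrite ?edge_refl.
split; apply/exists_inP; last by exists (prev c); rewrite ?edge_refl.
rewrite mem_diagonals in hd.
have h := turn_ccw glue_inj hd.
by exists (turn c); [rewrite in_edge; apply/orP; right|rewrite (ccw_vertex h)].
Qed.

Lemma mem_boundary_edges X c : X \subset diagonals G -> vertex c \in black G ->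
  (varpi c \in boundary_edges X) = (edge c \in X) (+) (edge (prev c) \in X).
Proof.
move=> /subsetP hX hc; rewrite inE.
have -> : [set d in X | varpi c \in square d] =
    X :&: [set edge c; edge (prev c)].
  apply/setP=> d; rewrite [LHS]in_set in_setI in_set2.
  case hd: (d \in X) => //=.
  by rewrite varpi_square // hX.
rewrite setIC setIUl cardsU.
have -> : [set edge c] :&: X :&: ([set edge (prev c)] :&: X) = set0.
  apply/setP=> d; rewrite !inE; apply/negP.
  case/andP=> /andP[/eqP-> _] /andP[/eqP e _].
  by move: (edge_prev_neq c); rewrite e eqxx.
rewrite cards0 subn0.
have h1 d : #|[set d] :&: X| = (d \in X) :> nat.
  have [h|h] := boolP (d \in X).
    by rewrite (setIidPl _) ?sub1set // cards1.
  by apply/eqP; rewrite cards_eq0 setI_eq0 disjoints1.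
by rewrite !h1; do 2 case: (_ \in X).
Qed.

Lemma boundary_edges_sub X : X \subset diagonals G ->
  boundary_edges X \subset graph_edges G.
Proof.
move=> hX; apply/subsetP=> e; rewrite inE => /eqP h.
have : (0 < #|[set d in X | e \in square d]|)%N by rewrite h.
by case/card_gt0P=> d; rewrite inE => /andP[_]; rewrite inE => /andP[].
Qed.

Lemma in_symdiff (T : finType) (A B : {set T}) (c : T) :
  (c \in symdiff A B) = (c \in A) (+) (c \in B).
Proof. by rewrite !inE; do 2 case: (_ \in _). Qed.

(** * The difference with the minimal matching and the squares it bounds *)

Section Matching.
Variable E : {set graph_edge G}.
Hypothesis hE : perfect_matching E.
Let A := varpi_inv E.

Lemma varpi_inv_black c : c \in A -> vertex c \in black G.
Proof. by rewrite inE => /andP[]. Qed.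

Lemma mem_varpi_inv c : (c \in A) = (varpi c \in E).
Proof.
rewrite inE; apply: andb_idl; case/and3P: hE => /subsetP h _ _ /h.
by rewrite varpi_graph_edge.
Qed.

Lemma card_varpi_inv (Q : pred (graph_edge G)) :
  #|[set c in A | Q (varpi c)]| = #|[set e in E | Q e]|.
Proof.
rewrite -(card_imset _ varpi_inj); apply: eq_card => e.
apply/imsetP/idP => [[c h ->]|].
  by move: h; rewrite inE mem_varpi_inv => h; rewrite inE.
rewrite inE => /andP[h hQ]; case/and3P: hE => /subsetP /(_ _ h).
by case/graph_edgeP=> c hc e' _ _; exists c => //; rewrite inE mem_varpi_inv -e' h.
Qed.

Lemma varpi_inv_matching : angle_matching A.
Proof.
case/and3P: hE => h0 /forall_inP h1 /forallP h2; apply/andP; split.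
  apply/forall_inP=> v hv; apply/eqP; apply: etrans (eqP (h1 v hv)).
  rewrite -(card_varpi_inv (fun e => e.1 == v)).
  apply: eq_card => c; rewrite in_setI [in RHS]inE /=.
  congr andb; move: hv; rewrite inE => /andP[/imsetP[c' _ ->] _].
  by rewrite in_vertex.
apply/forallP=> t; apply/eqP; apply: etrans (eqP (h2 t)).
by rewrite -(card_varpi_inv (fun e => e.2 == t)).
Qed.

Lemma matching_vertex M v : angle_matching M -> v \in black G ->
  #|M :&: v| = 1%N.
Proof. by move=> /andP[/forall_inP h _] /h /eqP. Qed.

Lemma matching_uniq M c c' : angle_matching M -> vertex c \in black G ->
  c' \in vertex c -> c \in M -> c' \in M -> c' = c.
Proof.
move=> hM hc h1 h2 h3.
have /eqP/cards1P[x hx] := matching_vertex hM hc.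
have hin y : y \in vertex c -> y \in M -> y = x.
  by move=> a b; apply/set1P; rewrite -hx in_setI a b.
by rewrite (hin c) ?vertex_refl // (hin c').
Qed.

Lemma matching_tri M t : angle_matching M -> #|[set c in M | c.1 == t]| = 1%N.
Proof. by move=> /andP[_ /forallP h]; apply/eqP. Qed.

Notation minM := (minimal_matching G).
Hypothesis hMmin : is_minimal minM.
Hypothesis hMblack : forall c, c \in minM -> vertex c \in black G.

Let hM : angle_matching minM. Proof. by case/andP: hMmin. Qed.

Let D c := (c \in minM) (+) (c \in A).

Lemma xor_difference_tri t : \big[addb/false]_(c | c.1 == t) D c = false.
Proof.
rewrite big_split /= !xor_card !matching_tri //.
exact: varpi_inv_matching.
Qed.

Lemma xor_difference_vertex v : v \in vertices G ->
  \big[addb/false]_(c in v) D c = false.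
Proof.
move=> /imsetP[c0 _ ->].
have [hb|hb] := boolP (vertex c0 \in black G).
  rewrite big_split /= !xor_card.
  have e (B : {set corner G}) :
      [set c in B | c \in vertex c0] = B :&: vertex c0.
    by apply/setP=> c; rewrite [LHS]in_set in_setI.
  by rewrite !e !matching_vertex ?varpi_inv_matching.
rewrite big1 // => c hc.
have hc' : vertex c \notin black G by rewrite (vertexE hc).
rewrite /D (contraNF (@hMblack c) hc').
by rewrite (contraNF (@varpi_inv_black c) hc').
Qed.

Variable x : side G -> bool.
Hypothesis x_glued : forall s s', glued s s' -> x s = x s'.
Hypothesis x_boundary : forall s, boundary s -> x s = false.
Hypothesis x_diff : forall c, D c = x c (+) x (prev c).

(** This shows that the [pick] in [bounded_squares] does not fall back to its default: the diagonals
    on which the potential [x] is true form a valid choice. *)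
Lemma exists_bounded_squares : exists2 X : {set {set side G}},
  X \subset diagonals G &
  boundary_edges X = symdiff (minimal_perfect_matching G) E.
Proof.
pose X := [set edge s | s : side G & inner s && x s].
(* The equality also holds at boundary sides, where [x_boundary] makes both members false. *)
have hX s : (edge s \in X) = x s.
  apply/imsetP/idP => [[s']|hs].
    rewrite inE => /andP[h1 h2] e; have := edge_refl s; rewrite e in_edge.
    by case/predU1P=> [-> //|/x_glued <-].
  exists s => //; rewrite inE hs andbT; apply: contraLR hs.
  by move/x_boundary->.
have sX : X \subset diagonals G.
  by apply/subsetP=> d /imsetP[s]; rewrite inE => /andP[h _] ->;
    rewrite mem_diagonals.
exists X => //; apply/setP=> e.
have [he|he] := boolP (e \in graph_edges G).
  case/graph_edgeP: he => c hc ->.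
  rewrite mem_boundary_edges // !hX -x_diff in_symdiff -mem_varpi_inv.
  by rewrite /minimal_perfect_matching mem_imset //; exact: varpi_inj.
rewrite (contraNF (subsetP (boundary_edges_sub sX) e) he) in_symdiff.
have -> : (e \in E) = false.
  by apply: contraNF he; case/and3P: hE => /subsetP h _ _ /h.
rewrite addbF /minimal_perfect_matching; apply/esym.
by apply: contraNF he => /imsetP[c /hMblack hc ->]; rewrite varpi_graph_edge.
Qed.

Let X := bounded_squares E.

Lemma bounded_squaresP : X \subset diagonals G /\
  boundary_edges X = symdiff (minimal_perfect_matching G) E.
Proof.
rewrite /X /bounded_squares; case: pickP => [Y /andP[h /eqP] //|h].
case: exists_bounded_squares => Y h1 h2.
by move: (h Y); rewrite h1 h2 eqxx.
Qed.

(** The set returned by [pick] is not compared with the one built from [x]; the arguments below rest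
    on this equation, which any valid choice satisfies. *)
Lemma mem_bounded_squares c : vertex c \in black G ->
  D c = (edge c \in X) (+) (edge (prev c) \in X).
Proof.
case: bounded_squaresP => h1 h2 hc.
rewrite -mem_boundary_edges // h2 in_symdiff /D mem_varpi_inv.
by rewrite /minimal_perfect_matching mem_imset //; exact: varpi_inj.
Qed.

Lemma bounded_squares_boundary s : boundary s -> (edge s \in X) = false.
Proof.
case: bounded_squaresP => /subsetP h _; apply: contraNF => /h.
by rewrite mem_diagonals.
Qed.

(** One of the two terms in the equation at an exterior angle vanishes, so that [D c] reads off the
    membership of the only diagonal there. *)
Lemma exterior_side c : exterior c -> exists2 s,
  edge s = edge c \/ edge s = edge (prev c) &
  [/\ inner s, D c = (edge s \in X) &
      forall d, d \in diagonals G -> d == edge c \/ d == edge (prev c) ->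
      d = edge s].
Proof.
rewrite /exterior /boundary => h.
have hb : vertex c \in black G.
  by apply: black_corner; move: h; do 2 case: (inner _).
have hD := mem_bounded_squares hb.
have [hc|hc] := boolP (inner c).
  have hp : boundary (prev c) by move: h; rewrite hc.
  exists c; [by left|split=> //].
    by rewrite hD (bounded_squares_boundary hp) addbF.
  by move=> d hd [/eqP //|/eqP e]; move: hp; rewrite /boundary -mem_diagonals -e hd.
have hp : inner (prev c) by move: h; rewrite hc; case: (inner _).
exists (prev c); [by right|split=> //].
  by rewrite hD (bounded_squares_boundary hc).
by move=> d hd [/eqP e|/eqP //]; move: hc; rewrite -mem_diagonals -e hd.
Qed.

Definition has_exterior d :=
  exists2 c, exterior c & d == edge c \/ d == edge (prev c).

Lemma Y'P d : d \in Y' A <->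
  [/\ d \in diagonals G, d \in X & has_exterior d].
Proof.
rewrite inE; split.
  case/andP=> hd /exists_inP[c hc /andP[he /exists_inP[s hs hs']]].
  have hdc : d == edge c \/ d == edge (prev c).
    case/diagonalP: hd hs => s0 _ -> /edgeE <-.
    by case/orP: hs' => /eqP->; [left|right].
  split=> //; last by exists c.
  case: (exterior_side he) => s1 _ [_ h2 /(_ d hd hdc) ->].
  by rewrite -h2 /D -in_symdiff.
case=> hd hX [c he hdc]; rewrite hd; apply/exists_inP; exists c.
  case: (exterior_side he) => s1 _ [_ h2 h3].
  by rewrite in_symdiff -/(D c) h2 -(h3 d).
rewrite he; apply/exists_inP.
case: hdc => /eqP->; [exists c|exists (prev c)];
  by rewrite ?edge_refl ?/at_corner ?eqxx ?orbT.
Qed.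

Lemma bounded_squares_I d : d \in X -> d \in I_ E.
Proof.
move=> hd; rewrite inE; case: bounded_squaresP => /subsetP h _.
by rewrite h //=; apply: (bigcup_sup d).
Qed.

(* The edge of B at an exterior angle lies in only one square. *)
Lemma I_bounded_squares d : has_exterior d -> d \in I_ E -> d \in X.
Proof.
case=> c he hdc; rewrite inE => /andP[hd /subsetP hs].
have hb : vertex c \in black G.
  apply: black_corner; move: he; rewrite /exterior /boundary.
  by do 2 case: (inner _).
have : varpi c \in square d by rewrite varpi_square //; apply/orP.
move/hs/bigcupP=> [d' hd' h'].
have hdd' : d' \in diagonals G.
  by case: bounded_squaresP => /subsetP h _; exact: h.
move: h'; rewrite varpi_square // => /orP hdc'.
by case: (exterior_side he) => s _ [_ _ h]; rewrite (h d) // -(h d').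
Qed.

(** * The last two angles at a boundary vertex *)

Section SecondLast.
Variables f f' : corner G.
Hypothesis hf : inner f.
Hypothesis hff' : glued (prev f) f'.
Hypothesis hf' : boundary (prev f').

Let f_black : vertex f \in black G.
Proof. by apply: black_corner; rewrite hf. Qed.

Let f'_vertex : vertex f' = vertex f.
Proof. exact: (ccw_vertex hff'). Qed.

Let f_boundary : boundary_vertex (vertex f).
Proof.
rewrite /boundary_vertex mem_vertices //= /puncture mem_vertices //=.
apply/forall_inPn; exists f'; first by rewrite -f'_vertex vertex_refl.
by rewrite negb_and orbC; move: hf'; rewrite /boundary => ->.
Qed.

Let not_first c : c \in vertex f -> inner c -> c \notin minM.
Proof.
move=> h1 h2; apply/negP=> h3; case/andP: hMmin => _ /forall_inP.
move/(_ _ f_black); rewrite f_boundary => /forall_inP /(_ c).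
(* The corner [next (mate c)] is the angle just before [c], so [c] is not a first angle. *)
rewrite in_setI h1 h3 => /(_ isT) /forallP /(_ (next (mate c))) /negP; apply.
by rewrite /ccw nextK glueC glued_mate.
Qed.

Let f'D : (edge (prev f) \in X) = (f' \in A).
Proof.
rewrite -(edge_glued hff').
have := @mem_bounded_squares f'; rewrite f'_vertex => /(_ f_black).
rewrite (bounded_squares_boundary hf') addbF => <-.
rewrite /D (negbTE (not_first _ _)) //.
  by rewrite -f'_vertex vertex_refl.
exact: glued_innerr hff'.
Qed.

(** Adding the equations at [f] and [f'] cancels the diagonal between these two angles. Neither
    angle is in the minimal matching, and [A] contains at most one of them, so the sum modulo 2 is a
    disjunction. *)
Lemma second_last_bounded_squares : (edge f \in X) = (f \in A) || (f' \in A).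
Proof.
have := mem_bounded_squares f_black.
rewrite f'D /D (negbTE (not_first (vertex_refl f) hf)) /=.
case h1: (f \in A); case h2: (f' \in A); case: (_ \in X) => //= _.
have := matching_uniq varpi_inv_matching f_black _ h1 h2.
rewrite -f'_vertex vertex_refl => /(_ isT) e.
by move: hf'; rewrite e /boundary (glued_inner hff').
Qed.

(** The edge of B at [f] lies in the squares of [edge f] and of [edge (prev f)]. If the second one
    is chosen, then [f'] is in [A], and the preceding lemma shows that the first one is chosen as
    well. *)
Lemma second_last_I : edge f \in I_ E -> edge f \in X.
Proof.
rewrite inE => /andP[hd /subsetP hs].
have : varpi f \in square (edge f) by rewrite varpi_square // eqxx.
move/hs/bigcupP=> [d' hd' h'].
have hdd' : d' \in diagonals G.
  by case: bounded_squaresP => /subsetP h _; exact: h.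
move: h'; rewrite varpi_square // => /orP[]/eqP e; first by rewrite -e.
by rewrite second_last_bounded_squares orbC -f'D -e hd'.
Qed.

End SecondLast.
End Matching.

(** * Existence of the minimal matching, with [H] its angles at the punctures *)

Section Minimal.
Variable H : {set corner G}.
Hypothesis inner_side : forall t, exists i, inner (t, i).
Hypothesis hub_tri : forall t, (forall i, inner (t, i)) ->
  exists2 h, h \in H & h.1 = t.
Hypothesis hub_inner : forall h i, h \in H -> inner (h.1, i).
Hypothesis hub_uniq : forall h h', h \in H -> h' \in H -> h.1 = h'.1 -> h = h'.
Hypothesis hub_puncture : forall h, h \in H -> puncture (vertex h).
Hypothesis hub_vertex : forall h h', h \in H -> h' \in H ->
  vertex h = vertex h' -> h = h'.
Hypothesis puncture_hub : forall c, puncture (vertex c) ->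
  exists2 h, h \in H & vertex h = vertex c.

Definition first_exterior c := boundary c && inner (prev c).

(** In the cyclic order of the three sides, the boundary sides form one run and the inner sides
    another; the corner is the one where the boundary run starts. *)
Lemma first_exterior_tri t : (exists i, boundary (t, i)) ->
  exists2 c, first_exterior c & c.1 = t.
Proof.
case=> i hi; have [h|h] := boolP (inner (prev (t, i))).
  by exists (t, i) => //; rewrite /first_exterior hi.
exists (prev (t, i)) => //; rewrite /first_exterior [boundary _]h prev_prev /=.
case: (inner_side t) => j; case: (@corner_cases G (t, i) (t, j)) => // -> //.
  by move=> h'; move: hi; rewrite /boundary h'.
by move=> h'; move: h; rewrite h'.
Qed.

Lemma first_exterior_uniq c c' : first_exterior c -> first_exterior c' ->
  c'.1 = c.1 -> c' = c.
Proof.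
move=> /andP[h1 h2] /andP[h3 h4] /corner_cases [] // e.
  by move: h4 h1; rewrite e nextK /boundary => ->.
by move: h3 h2; rewrite e /boundary => /negbTE->.
Qed.

Lemma boundary_or_inner t :
  (exists i, boundary (t, i)) \/ (forall i, inner (t, i)).
Proof.
have [/existsP h|/existsPn h] := boolP [exists i, boundary (t, i)].
  by left.
by right=> i; have := h i; rewrite /boundary negbK.
Qed.

Lemma puncture_inner c : puncture (vertex c) -> inner c && inner (prev c).
Proof. by case/andP=> _ /forall_inP; apply; exact: vertex_refl. Qed.

Lemma first_exterior_first c : first_exterior c = first_angle c && inner (prev c).
Proof.
congr andb; apply/idP/forallP => [h c'|h].
  by apply: contra h; exact: glued_innerr.
apply/negP=> h'; move: (h (next (mate c))); rewrite /ccw nextK glueC.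
by rewrite glued_mate.
Qed.

Definition minimal_candidate := [set c | first_exterior c] :|: H.

(** If the first angle at [v] ended at a boundary side, it would be the only angle at [v], and [v]
    would meet no diagonal. *)
Lemma black_boundary_vertex v : v \in black G -> boundary_vertex v ->
  exists2 c, first_exterior c & v = vertex c.
Proof.
move=> hb hv; have [c hc hbd] := exists_boundary_start glueC glue_inj hv.
have e := black_vertex hb hc; exists c => //; rewrite /first_exterior hbd /=.
apply: contraLR hb => he; rewrite e in_black; apply/exists_inPn=> c' hc'.
suff -> : c' = c by rewrite negb_or he andbT.
apply/eqP; apply: (@vertex_closed _ (pred1 c) c c') => //= a b hab.
apply/eqP/eqP => h; [move: he|move: hbd]; subst.
  by rewrite (glued_inner hab).
by rewrite /boundary (glued_innerr glueC hab).
Qed.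

(** A triangle with a boundary side contributes its [first_exterior] corner, a triangle with three
    inner sides its hub. Likewise a black boundary vertex is served by its first angle and a
    puncture by its hub, so both counts equal one. *)
Lemma minimal_candidateP : is_minimal minimal_candidate.
Proof.
apply/andP; split; last first.
  apply/forall_inP=> v hv; apply/implyP=> hb; apply/forall_inP=> c.
  rewrite in_setI => /andP[]; rewrite in_setU => /orP[|hc hcv].
    by rewrite inE first_exterior_first => /andP[].
  case/andP: hb => _ /negP[]; rewrite (black_vertex hv hcv).
  exact: hub_puncture.
apply/andP; split.
  apply/forall_inP=> v hv; apply/cards1P.
  have [hp|hp] := boolP (puncture v).
    have [c _ e] : exists2 c, c \in [set: corner G] & v = vertex c.
      by move: hv; rewrite inE => /andP[/imsetP[c h ->] _]; exists c.
    rewrite e in hp *; case/puncture_hub: (hp) => h hH eh; exists h.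
    apply/setP=> c'; rewrite in_setI in_setU !inE -[connect _ _ _]in_set.
    rewrite -/(vertex c) -eh in_vertex; apply/andP/eqP => [[/orP[]]|->].
    - move=> /andP[h1 _] /eqP h2; case/negP: h1.
      by move: hp; rewrite -eh -h2 => /puncture_inner /andP[].
    - by move=> h1 /eqP h2; apply: hub_vertex.
    - by rewrite hH orbT eqxx.
  have hbd : boundary_vertex v.
    by rewrite /boundary_vertex hp andbT; move: hv; rewrite inE => /andP[].
  case: (black_boundary_vertex hv hbd) => c hc e; exists c.
  rewrite e in hp *; apply/setP=> c'; rewrite in_setI in_setU !inE.
  rewrite -[connect _ _ _]in_set -/(vertex c).
  apply/andP/eqP => [[/orP[h1 h2|h1 h2]]|->].
  - case/andP: hc h1 => hc _ /andP[h1 _].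
    exact: (boundary_start_uniq glueC glue_inj hc h1 h2).
  - by move: hp; rewrite -(vertexE h2) hub_puncture.
  - by rewrite hc vertex_refl.
apply/forallP=> t; apply/cards1P.
case: (boundary_or_inner t) => ht.
  case: (first_exterior_tri ht) => c hc e; exists c.
  apply/setP=> c'; rewrite !inE; apply/andP/eqP => [[/orP[h1|h1] /eqP h2]|->].
  - by apply: first_exterior_uniq => //; rewrite h2.
  - by case: ht => i; rewrite /boundary -h2 hub_inner.
  - by rewrite hc e.
case: (hub_tri ht) => h hH e; exists h.
apply/setP=> c'; rewrite !inE; apply/andP/eqP => [[/orP[h1|h1] /eqP h2]|->].
- by case/andP: h1; rewrite /boundary; case: c' h2 => a b /= ->; rewrite ht.
- by apply: hub_uniq => //; rewrite h2.
- by rewrite hH orbT e.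
Qed.

Lemma minimal_matchingP : is_minimal (minimal_matching G).
Proof.
rewrite /minimal_matching; case: pickP => [//|/(_ minimal_candidate)].
by rewrite minimal_candidateP.
Qed.

(** The condition on triangles alone could be met by an angle at a vertex that is not black. In a
    triangle with a boundary side, however, minimality at the black vertex of the [first_exterior]
    corner puts this corner in [M], and the triangle has room for no other angle. *)
Lemma minimal_black M c : is_minimal M -> c \in M -> vertex c \in black G.
Proof.
move=> hM hc; have hm : angle_matching M by case/andP: hM.
case: (boundary_or_inner c.1) => ht; last first.
  by apply: black_corner; case: {hc} c ht => t i /= ->.
case: (first_exterior_tri ht) => c' hc' e.
have hb : vertex c' \in black G.
  by apply: black_corner; case/andP: hc' => _ ->; rewrite orbT.
have bd : boundary_vertex (vertex c').
  rewrite /boundary_vertex mem_vertices //=; apply/negP=> /puncture_inner.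
  by case/andP=> h _; case/andP: hc' => /negP.
have /eqP/cards1P[y hy] := matching_vertex hm hb.
have : y \in M :&: vertex c' by rewrite hy inE.
rewrite in_setI => /andP[hyM hyv].
case/andP: hM => _ /forall_inP /(_ _ hb); rewrite bd => /forall_inP /(_ y).
rewrite in_setI hyM hyv => /(_ isT) hyf.
have ey : y = c'.
  case/andP: hc' => h1 _; apply: (boundary_start_uniq glueC glue_inj h1) => //.
  apply/negP=> h'; move/forallP: hyf => /(_ (next (mate y))) /negP[].
  by rewrite /ccw nextK glueC glued_mate.
suff -> : c = c' by [].
have /eqP/cards1P[z hz] := matching_tri c.1 hm.
have h1 : c \in [set z] by rewrite -hz inE hc eqxx.
have h2 : c' \in [set z] by rewrite -hz inE -{1}ey hyM e eqxx.
by rewrite (set1P h1) (set1P h2).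
Qed.

End Minimal.
End Squares.

(** * Turning around a puncture *)

Section Fan.
Variable G : gluing.
Hypothesis glueC : symmetric (@glued G).
Hypothesis glue_inj : forall s s1 s2 : side G,
  glued s s1 -> glued s s2 -> s1 = s2.
Variable c0 : corner G.
Hypothesis hp : puncture (vertex c0).
Implicit Types c : corner G.
Notation turn := (@turn G).

Lemma turn_ccw_puncture c : c \in vertex c0 -> ccw c (turn c).
Proof.
move=> hc; apply: turn_ccw => //.
by case/andP: hp => _ /forall_inP /(_ c hc) /andP[].
Qed.

Lemma turn_vertex c : c \in vertex c0 -> turn c \in vertex c0.
Proof.
by move=> hc; rewrite in_vertex (ccw_vertex (turn_ccw_puncture hc)) (vertexE hc).
Qed.

Lemma iter_turn_vertex n : iter n turn c0 \in vertex c0.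
Proof. by elim: n => [|n ih] /=; rewrite ?vertex_refl ?turn_vertex. Qed.

(** An injective map of a finite set permutes it, so forward orbits of [turn] are closed under
    predecessors as well. *)
Lemma vertex_orbit c : (c \in vertex c0) = fconnect turn c0 c.
Proof.
apply/idP/idP => [hc|/iter_findex <-]; last exact: iter_turn_vertex.
apply: (vertex_closed _ hc) => // a b /(ccw_turn glue_inj) <-.
by rewrite (same_fconnect1_r (turn_inj glueC glue_inj)).
Qed.

Definition fan_position c := findex turn c0 c.

Lemma fan_position0 : fan_position c0 = 0%N.
Proof. exact: findex0. Qed.

Lemma fan_position1 : turn c0 != c0 -> fan_position (turn c0) = 1%N.
Proof.
move=> h; rewrite /fan_position; apply: (@findex_iter _ turn c0 1).
rewrite ltn_neqAle order_gt0 andbT; apply: contraNN h => /eqP h.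
by have := iter_order (turn_inj glueC glue_inj) c0; rewrite -h /= => ->.
Qed.

Lemma fan_position_inj : {in vertex c0 &, injective fan_position}.
Proof.
move=> c c'; rewrite !vertex_orbit => h h' e.
by rewrite -(iter_findex h) -(iter_findex h') -/(fan_position c) e.
Qed.

Lemma xor_turn (g : corner G -> bool) :
  \big[addb/false]_(c in vertex c0) g (turn c) =
  \big[addb/false]_(c in vertex c0) g c.
Proof.
rewrite [RHS](reindex_inj (turn_inj glueC glue_inj)) /=.
apply: eq_bigl => c; rewrite !vertex_orbit.
by rewrite (same_fconnect1_r (turn_inj glueC glue_inj)).
Qed.

(** Discrete integration of [g] around the puncture, starting from [b] at [c0]. *)
Lemma fan_potential (b : bool) (g : corner G -> bool) :
  \big[addb/false]_(c in vertex c0) g c = false ->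
  exists2 a : corner G -> bool, a c0 = b &
    forall c, c \in vertex c0 -> a c (+) a (turn c) = g c.
Proof.
move=> hg.
pose a n := b (+) \big[addb/false]_(0 <= l < n) g (iter l turn c0).
exists (fun c => a (fan_position c)).
  by rewrite fan_position0 /a big_geq // addbF.
move=> c; rewrite vertex_orbit => hc; have e := iter_findex hc.
have aS n : a n (+) a n.+1 = g (iter n turn c0).
  by rewrite /a big_nat_recr //= addbACA addbb addFb addKb.
(* Either [c] is the last corner before the return to [c0], where the vanishing total closes the
   potential, or [turn c] has the next position. *)
have := findex_max hc; rewrite leq_eqVlt => /orP[/eqP h|h].
  have e1 : turn c = c0.
    by rewrite -{1}e -[turn _]/(iter (findex turn c0 c).+1 turn c0) h iter_order
      //; exact: turn_inj.
  rewrite e1 fan_position0 -[in RHS]e -aS; congr addb.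
  rewrite /fan_position h /a big_geq // -[in LHS]hg; congr addb.
  rewrite big_mkord (eq_bigl (fun c => c \in orbit turn c0)); last first.
    by move=> x; rewrite vertex_orbit fconnect_orbit.
  rewrite -big_uniq ?orbit_uniq //= /orbit.
  by rewrite (big_nth c0) size_traject big_mkord; apply: eq_bigr => i _;
    rewrite nth_traject.
rewrite -[in RHS]e -aS; congr addb; congr a.
by rewrite -{1}e -[turn _]/(iter (findex turn c0 c).+1 turn c0) /fan_position
  findex_iter.
Qed.

(* By parity, a function that is invariant at all steps but one around the
   puncture is also invariant at the remaining step. *)
Lemma fan_constant (h : corner G -> bool) :
  (forall c, c \in vertex c0 -> c != c0 -> h c = h (turn c)) ->
  forall c, c \in vertex c0 -> h c = h c0.
Proof.
move=> hh.
have h0 : h (turn c0) = h c0.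
  have := xor_turn h; rewrite (bigD1 c0) ?vertex_refl //=.
  rewrite [RHS](bigD1 c0) ?vertex_refl //=.
  rewrite [X in h c0 (+) X](eq_bigr (fun c => h (turn c))); last first.
    by move=> c /andP[h1 h2]; exact: hh.
  by move/addIb.
have hn n : h (iter n turn c0) = h c0.
  elim: n => //= n <-; have [->//|hne] := eqVneq (iter n turn c0) c0.
  by rewrite -hh ?iter_turn_vertex.
by move=> c; rewrite vertex_orbit => /iter_findex <-.
Qed.

End Fan.

(** Integration around each triangle from the value [false] on side 0; the vanishing sum closes it
    up at corner 0. *)
Lemma tri_potential (G : gluing) (D : corner G -> bool) :
  (forall t, \big[addb/false]_(c | c.1 == t) D c = false) ->
  exists r : side G -> bool, forall c, D c = r c (+) r (prev c).
Proof.
move=> hD.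
exists (fun s => if s.2 == 0 then false else
  if s.2 == 0 + 1 then D (s.1, 0 + 1) else D (s.1, 0 + 1) (+) D (s.1, 0 - 1)).
case=> t z; rewrite /prev /=.
have : D (t, 0) (+) D (t, 0 + 1) (+) D (t, 0 - 1) = false.
  rewrite -[RHS](hD t) (reindex_onto (fun z => (t, z)) snd) /=; last first.
    by case=> t' z' /= /eqP ->.
  by rewrite (eq_bigl predT) ?(big_Z3 _ _ 0) // => i; rewrite /= !eqxx.
have n1 : ((0 - 1 : 'Z_3) == 0) = false by [].
have n2 : ((0 - 1 : 'Z_3) == 0 + 1) = false by [].
have n3 : ((0 + 1 : 'Z_3) == 0) = false by [].
case: (Z3_cases 0 z) => ->; rewrite ?addrK ?Z3_subr11 ?eqxx ?n1 ?n2 ?n3 ?eqxx;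
  by move: (D _) (D _) (D _) => [] [] [].
Qed.

(** * The polygon *)

Section Polygon.
Variable S : gluing.
Hypothesis glueC : symmetric (@glued S).
Hypothesis glue_inj : forall s s1 s2 : side S,
  glued s s1 -> glued s s2 -> s1 = s2.
Variables (k : nat) (gamma : k.+1.-tuple (side S * side S)) (nq np : bool).

(* The two ends q and p of the arc are indexed by [false] and [true]. *)
Definition notched (e : bool) := if e then np else nq.
Definition end_at (e : bool) := if e then end_corner gamma else start_corner gamma.
Hypothesis hred : reduced_curve gamma.
Hypothesis end_puncture : forall e, notched e -> puncture (vertex (end_at e)).
(** A notched end with a single corner would have an empty fan, and its end triangle would be glued
    to itself. *)
Hypothesis end_turn : forall e, notched e -> turn (end_at e) != end_at e.

Notation P := (polygon gamma nq np).
Notation turn := (@turn S).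

Definition end_tri (e : bool) : 'I_k.+2 := if e then ord_max else ord0.
Definition around (e : bool) (c : corner S) : tri P :=
  if e then around_p gamma nq np c else around_q gamma nq np c.
Definition strip_leave i : side P :=
  (strip gamma nq np (lift ord_max i), (leave gamma i).2).
Definition strip_enter i : side P :=
  (strip gamma nq np (lift ord0 i), (enter gamma i).2).
Definition fan_corner e c : corner P := (around e c, c.2).
Definition in_fan e c := notched e && (c \in vertex (end_at e)).

Lemma around_end e : around e (end_at e) = strip gamma nq np (end_tri e).
Proof.
by case: e; rewrite /around /= /around_p /around_q insubN // eqxx !andbF.
Qed.

Lemma aroundP e c : in_fan e c -> c != end_at e ->
  if e then exists2 u : fan np (end_corner gamma), around e c = inr u & val u = c
  else exists2 u : fan nq (start_corner gamma), around e c = inl (inr u) & val u = c.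
Proof.
case: e => /andP[h1 h2] h3; rewrite /around /around_p /around_q.
  have h : [&& np, c \in vertex (end_corner gamma) & c != end_corner gamma].
    by apply/and3P.
  by case: insubP => [u _ hu|]; [exists u|rewrite h].
have h : [&& nq, c \in vertex (start_corner gamma) & c != start_corner gamma].
  by apply/and3P.
by case: insubP => [u _ hu|]; [exists u|rewrite h].
Qed.

Lemma around_strip e c i : in_fan e c -> around e c = strip gamma nq np i ->
  c = end_at e /\ i = end_tri e.
Proof.
move=> hc; have [->|hne] := eqVneq c (end_at e).
  by rewrite around_end => -[->].
by case: e hc hne => hc hne; have [u -> _] := aroundP hc hne.
Qed.

Lemma around_inj e e' c c' : in_fan e c -> in_fan e' c' ->
  around e c = around e' c' -> e = e' /\ c = c'.
Proof.
move=> hc hc'; have [e1|hne] := eqVneq c (end_at e).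
  rewrite e1 around_end => /esym /(around_strip hc')[-> et].
  by case: e e' et {hc hc' e1} => [] [].
have [e1|hne'] := eqVneq c' (end_at e').
  by rewrite e1 around_end => /(around_strip hc)[h]; rewrite h eqxx in hne.
case: e e' hc hc' hne hne' => [] [] hc hc' hne hne';
  have [u -> <-] := aroundP hc hne; have [u' -> <-] := aroundP hc' hne';
  by first [case=> -> | done].
Qed.

Lemma in_fan_turn e c : in_fan e c -> in_fan e (turn c).
Proof.
move=> /andP[h1 h2]; rewrite /in_fan h1 /=.
by apply: turn_vertex => //; exact: end_puncture.
Qed.

Lemma in_fan_end e : notched e -> in_fan e (end_at e).
Proof. by move=> h; rewrite /in_fan h vertex_refl. Qed.

Lemma in_fan_turn_inv e c : in_fan e c ->
  exists2 c', in_fan e c' & turn c' = c.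
Proof.
move=> /andP[h1 h2].
have hp := end_puncture h1.
exists (next (mate c)); last by rewrite /turn nextK mateK.
rewrite /in_fan h1 /=.
have hi : inner c by case/andP: hp => _ /forall_inP /(_ c h2) /andP[].
by rewrite in_vertex -(vertexE h2); apply/eqP/esym/ccw_vertex;
  rewrite /ccw nextK glueC glued_mate.
Qed.

(** * The seams: each side is glued to at most one other *)

Notation seamed := (@seam S k gamma nq np).

Lemma seamP s s' : seamed s s' <->
  (exists i, s = strip_leave i /\ s' = strip_enter i) \/
  (exists e c, [/\ in_fan e c, s = prev (fan_corner e c) &
                   s' = fan_corner e (turn c)]).
Proof.
split.
  case/or3P=> [/existsP[i /andP[/eqP-> /eqP->]]|
      /andP[h /exists_inP[c hc /existsP[c' /and3P[h' /eqP-> /eqP->]]]]|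
      /andP[h /exists_inP[c hc /existsP[c' /and3P[h' /eqP-> /eqP->]]]]].
  - by left; exists i.
  - by right; exists false, c; rewrite (ccw_turn glue_inj h'); split=> //; apply/andP.
  - by right; exists true, c; rewrite (ccw_turn glue_inj h'); split=> //; apply/andP.
case=> [[i [-> ->]]|[e [c [hc -> ->]]]].
  by apply/orP; left; apply/existsP; exists i; rewrite !eqxx.
have h' : ccw c (turn c).
  by case/andP: hc => h1 h2; apply: turn_ccw_puncture h2 => //; exact: end_puncture.
case: e hc => /andP[h1 h2]; rewrite /= in h1.
  apply/or3P/Or33/andP; split=> //; apply/exists_inP; exists c => //.
  by apply/existsP; exists (turn c); rewrite h' !eqxx.
apply/or3P/Or32/andP; split=> //; apply/exists_inP; exists c => //.
by apply/existsP; exists (turn c); rewrite h' !eqxx.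
Qed.

(** The equality of lifts says that j = i + 1: the strip triangle entered at crossing [i] is the one
    left at crossing [j]. This indexing recurs below for the middle triangles. *)
Lemma strip_reduced i j : lift ord_max j = lift ord0 i :> 'I_k.+2 ->
  (enter gamma i).2 != (leave gamma j).2.
Proof.
move=> /(congr1 (@nat_of_ord _)); rewrite lift_max lift0 => hij.
case: hred => _ /(sortedP (leave gamma i, leave gamma i)) /(_ i).
rewrite size_tuple -hij => /(_ (ltn_ord j)) /andP[/eqP h1].
rewrite -!tnth_nth in h1 *; apply: contraNN => /eqP h2.
apply/eqP; rewrite [LHS]surjective_pairing [RHS]surjective_pairing.
by rewrite h1 [X in (_, X)]h2.
Qed.

Definition opposite_end (e : bool) : side P :=
  if e then strip_enter ord_max else strip_leave ord0.

Lemma fan_corner_end e : fan_corner e (end_at e) = prev (opposite_end e).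
Proof.
rewrite /fan_corner around_end; case: e => /=; congr (inl (inl _), _);
  by apply: val_inj; rewrite /= ?lift_max // lift0.
Qed.

Lemma next_neq (G : gluing) (c : corner G) : next c <> c.
Proof. by move/(congr1 snd)/eqP; rewrite /= Z3_addr1_neq. Qed.

Lemma prev_neq (G : gluing) (c : corner G) : prev c <> c.
Proof. by move/(congr1 snd)/eqP; rewrite /= Z3_subr1_neq. Qed.

Lemma next_prev_neq (G : gluing) (c : corner G) : next c <> prev c.
Proof. by move/(congr1 snd)/eqP; rewrite /= Z3_addr1_subr1_neq. Qed.

Lemma strip_inj : injective (@strip S k gamma nq np).
Proof. by move=> i j []. Qed.

Lemma strip_leave_inj : injective strip_leave.
Proof. by move=> i j /(congr1 fst) /strip_inj /lift_inj. Qed.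

Lemma strip_enter_inj : injective strip_enter.
Proof. by move=> i j /(congr1 fst) /strip_inj /lift_inj. Qed.

Lemma strip_enter_leave i j : strip_enter i <> strip_leave j.
Proof. 
move=> h; have /esym/strip_reduced/eqP := strip_inj (congr1 fst h).
by case; exact: (congr1 snd h).
Qed.

Lemma strip_leave_tri i e : lift ord_max i = end_tri e ->
  strip_leave i = opposite_end e.
Proof.
case: e => [/eqP|/(congr1 (@nat_of_ord _))].
  by rewrite eq_sym (negbTE (neq_lift _ _)).
by rewrite lift_max => h /=; congr strip_leave; apply: val_inj.
Qed.

Lemma strip_enter_tri i e : lift ord0 i = end_tri e ->
  strip_enter i = opposite_end e.
Proof.
case: e => [/(congr1 (@nat_of_ord _))|/eqP]; last
  by rewrite eq_sym (negbTE (neq_lift _ _)).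
by rewrite lift0 /= => -[h]; congr strip_enter; apply: val_inj.
Qed.

Definition crosses (s : side P) :=
  (exists i, s = strip_leave i) \/ (exists i, s = strip_enter i).

(** Only the end triangle belongs both to the fan and to the strip, and there the crossed side is
    opposite to the puncture. Hence seams of the fan and of the strip never share a side. *)
Lemma crosses_fan e c s : in_fan e c -> crosses s -> s.1 = around e c ->
  s = next (fan_corner e c).
Proof.
move=> hc hs h.
have [e1 e2] : c = end_at e /\ exists i, s.1 = strip gamma nq np i /\ i = end_tri e.
  by case: hs h => -[i ->] /= /esym h; have [h1 h2] := around_strip hc h;
    split=> //; eexists; split.
case: e2 => i [e2 e3]; rewrite e1 fan_corner_end prevK.
case: hs e2 => -[j ->] /= /strip_inj ej;
  [apply: strip_leave_tri|apply: strip_enter_tri];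
  by rewrite ej.
Qed.

Lemma glued_polygonP s s' : glued (g := P) s s' <-> seamed s s' \/ seamed s' s.
Proof. by split=> /orP. Qed.

Lemma polygon_glueC : symmetric (@glued P).
Proof. by move=> s s'; rewrite /glued /= orbC. Qed.

Lemma fan_corner_inj e e' c c' : in_fan e c -> in_fan e' c' ->
  (fan_corner e c).1 = (fan_corner e' c').1 -> e = e' /\ c = c'.
Proof. by move=> h h' /=; exact: around_inj. Qed.

Lemma seam_fun s s1 s2 : seamed s s1 -> seamed s s2 -> s1 = s2.
Proof.
move=> /seamP[[i [-> ->]]|[e [c [hc -> ->]]]] /seamP[[j [h ->]]|[e' [c' [hc' h ->]]]].
- by rewrite (strip_leave_inj h).
- have := crosses_fan hc' (or_introl (ex_intro _ i erefl)).
  by rewrite h => /(_ erefl) /esym /next_prev_neq.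
- have := crosses_fan hc (or_introl (ex_intro _ j erefl)).
  by rewrite -h => /(_ erefl) /esym /next_prev_neq.
- by have [-> ->] := fan_corner_inj hc hc' (congr1 fst h).
Qed.

Lemma seam_inj s s1 s2 : seamed s1 s -> seamed s2 s -> s1 = s2.
Proof.
move=> /seamP[[i [-> ->]]|[e [c [hc -> ->]]]] /seamP[[j [-> h]]|[e' [c' [hc' -> h]]]].
- by rewrite (strip_enter_inj h).
- have := crosses_fan (in_fan_turn hc') (or_intror (ex_intro _ i erefl)).
  by rewrite h => /(_ erefl) /esym /next_neq.
- have := crosses_fan (in_fan_turn hc) (or_intror (ex_intro _ j erefl)).
  by rewrite -h => /(_ erefl) /esym /next_neq.
- have [ee /(turn_inj glueC glue_inj) ->] :=
    fan_corner_inj (in_fan_turn hc) (in_fan_turn hc') (congr1 fst h).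
  by rewrite ee.
Qed.

Lemma seam_asym s s1 s2 : seamed s s1 -> seamed s2 s -> False.
Proof.
move=> /seamP[[i [-> _]]|[e [c [hc -> _]]]] /seamP[[j [_ h]]|[e' [c' [hc' _ h]]]].
- exact: strip_enter_leave (esym h).
- have := crosses_fan (in_fan_turn hc') (or_introl (ex_intro _ i erefl)).
  by rewrite h => /(_ erefl) /esym /next_neq.
- have := crosses_fan hc (or_intror (ex_intro _ j erefl)).
  by rewrite -h => /(_ erefl) /esym /next_prev_neq.
- have [ee ec] := fan_corner_inj hc (in_fan_turn hc') (congr1 fst h).
  by rewrite ee ec in h; case: (@prev_neq P _ h).
Qed.

(** As a directed relation [seam] is functional and injective, and no side is both a source and a
    target; so its symmetric closure is still functional. *)
Lemma polygon_glue_inj s s1 s2 :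
  glued (g := P) s s1 -> glued (g := P) s s2 -> s1 = s2.
Proof.
move=> /glued_polygonP[h1|h1] /glued_polygonP[h2|h2].
- exact: seam_fun h1 h2.
- by case: (seam_asym h1 h2).
- by case: (seam_asym h2 h1).
- exact: seam_inj h1 h2.
Qed.

Lemma glued_strip i : glued (g := P) (strip_leave i) (strip_enter i).
Proof. by apply/glued_polygonP; left; apply/seamP; left; exists i. Qed.

Lemma glued_fan e c : in_fan e c ->
  glued (g := P) (prev (fan_corner e c)) (fan_corner e (turn c)).
Proof. by move=> h; apply/glued_polygonP; left; apply/seamP; right; exists e, c. Qed.

(** * Inner and boundary sides of the polygon *)

Lemma inner_crosses s : crosses s -> inner (G := P) s.
Proof.
case=> -[i ->]; first exact: (@glued_inner P _ _ (glued_strip i)).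
exact: (@glued_innerr P polygon_glueC _ _ (glued_strip i)).
Qed.

Lemma inner_prev_fan e c : in_fan e c -> inner (prev (fan_corner e c)).
Proof. by move=> h; exact: glued_inner (glued_fan h). Qed.

Lemma inner_fan e c : in_fan e c -> inner (fan_corner e c).
Proof.
move=> h; case: (in_fan_turn_inv h) => c' h' <-.
exact: (@glued_innerr P polygon_glueC _ _ (glued_fan h')).
Qed.

Lemma innerP (s : side P) : inner s -> crosses s \/
  exists e c, in_fan e c /\ (s = fan_corner e c \/ s = prev (fan_corner e c)).
Proof.
case/existsP=> s' /glued_polygonP[] /seamP.
- case=> [[i [-> _]]|[e [c [h -> _]]]]; first by left; left; exists i.
  by right; exists e, c; split=> //; right.
- case=> [[i [_ ->]]|[e [c [h _ ->]]]]; first by left; right; exists i.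
  by right; exists e, (turn c); split; [exact: in_fan_turn|left].
Qed.

Lemma fan_outer_boundary e c : in_fan e c -> c != end_at e ->
  boundary (next (fan_corner e c)).
Proof.
move=> hc hne; apply/negP=> /innerP[h|[e' [c' [hc' h]]]].
  have hs : crosses (next (fan_corner e c)) := h.
  case: h => -[i /(congr1 fst) /= /(around_strip hc)[h _]]; move: hne;
    by rewrite h eqxx.
have [ee ec] : e = e' /\ c = c'.
  by apply: fan_corner_inj => //; case: h => /(congr1 fst).
by rewrite ee ec in h; case: h => [/(@next_neq P)|/(@next_prev_neq P)].
Qed.

Lemma end_boundary e : ~~ notched e ->
  boundary (next (opposite_end e)) /\ boundary (prev (opposite_end e)).
Proof.
move=> hn.
have hc : crosses (opposite_end e).
  by case: e {hn}; [right; exists ord_max|left; exists ord0].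
have key s : s.1 = (opposite_end e).1 -> s <> opposite_end e -> boundary s.
  move=> h1 h2; apply/negP=> /innerP[|[e' [c' [hc' h]]]].
    have h3 : s.1 = strip gamma nq np (end_tri e).
      by rewrite h1; have /(congr1 fst) /= <- := fan_corner_end e; rewrite around_end.
    case=> -[i hi]; apply: h2; rewrite hi; move: h3; rewrite hi => /strip_inj h3.
      exact: strip_leave_tri.
    exact: strip_enter_tri.
  have h3 : around e' c' = strip gamma nq np (end_tri e).
    have : s.1 = around e' c' by case: h => ->.
    move=> <-; rewrite h1; have /(congr1 fst) /= <- := fan_corner_end e.
    by rewrite around_end.
  have [_ ee] := around_strip hc' h3.
  have ee' : e = e' by case: e e' ee {hn hc h1 h2 hc' h h3} => [] [].
  by case/andP: hc'; rewrite -ee' (negbTE hn).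
by split; apply: key => //; [exact: next_neq|exact: prev_neq].
Qed.

Lemma middle_boundary i j s : lift ord_max j = lift ord0 i :> 'I_k.+2 ->
  s.1 = (strip_enter i).1 -> s <> strip_enter i -> s <> strip_leave j ->
  boundary (G := P) s.
Proof.
move=> hij h1 h2 h3; apply/negP=> /innerP[|[e [c [hc h]]]].
  case=> -[l hl]; move: h1; rewrite hl => /strip_inj h1.
    apply: h3; rewrite hl; congr strip_leave; apply: (@lift_inj _ ord_max).
    by rewrite hij.
  by apply: h2; rewrite hl; congr strip_enter; apply: (@lift_inj _ ord0).
have [_ ee] : c = end_at e /\ lift ord0 i = end_tri e.
  by apply: (around_strip hc); case: h h1 => -> /= ->.
case: e ee {hc h} => ee.
  by move: hij; rewrite ee => /esym/eqP; rewrite (negbTE (neq_lift _ _)).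
by move/esym/eqP: ee; rewrite (negbTE (neq_lift _ _)).
Qed.

Lemma opposite_end_tri e : (opposite_end e).1 = strip gamma nq np (end_tri e).
Proof. by rewrite -around_end; have /(congr1 fst) := fan_corner_end e. Qed.

Lemma crosses_opposite_end e : crosses (opposite_end e).
Proof. by case: e; [right; exists ord_max|left; exists ord0]. Qed.

Lemma fan_corner_val e (c : corner S) (h : in_fan e c) (hne : c != end_at e) t :
  (if e then exists2 u : fan np (end_corner gamma), t = inr u & val u = c
   else exists2 u : fan nq (start_corner gamma), t = inl (inr u) & val u = c) ->
  t = around e c.
Proof.
have := aroundP h hne; case: e {h hne} => -[u -> <-] [u' -> /val_inj ->] //.
Qed.

Lemma tri_cases (t : tri P) : (exists i, t = strip gamma nq np i) \/
  exists e c, [/\ in_fan e c, c != end_at e & t = around e c].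
Proof.
case: t => [[i|u]|u]; first by left; exists i.
- right; exists false, (val u); case/and3P: (valP u) => h1 h2 h3.
  have hc : in_fan false (val u) by rewrite /in_fan h2 andbT.
  by split=> //; apply: fan_corner_val => //; exists u.
- right; exists true, (val u); case/and3P: (valP u) => h1 h2 h3.
  have hc : in_fan true (val u) by rewrite /in_fan h2 andbT.
  by split=> //; apply: fan_corner_val => //; exists u.
Qed.

Lemma strip_cases (i : 'I_k.+2) : (exists e, i = end_tri e) \/
  exists j l, lift ord_max j = lift ord0 l :> 'I_k.+2 /\ i = lift ord0 l.
Proof.
case: (unliftP ord0 i) => [l ->|->]; last by left; exists false.
case: (unliftP ord_max (lift ord0 l)) => [j e|->]; last by left; exists true.
by right; exists j, l.
Qed.

Lemma middle_corners i j : lift ord_max j = lift ord0 i :> 'I_k.+2 ->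
  strip_leave j = next (strip_enter i) /\ boundary (prev (strip_enter i)) \/
  strip_leave j = prev (strip_enter i) /\ boundary (next (strip_enter i)).
Proof.
move=> hij.
have h1 : (strip_leave j).1 = (strip_enter i).1 by rewrite /= hij.
have hb := middle_boundary hij.
case: (@corner_cases P _ _ h1) => e.
- by case: (@strip_enter_leave i j).
- left; split=> //; apply: hb => //; first exact: (@prev_neq P).
  by rewrite e => /esym /(@next_prev_neq P).
- right; split=> //; apply: hb => //; first exact: (@next_neq P).
  by rewrite e => /(@next_prev_neq P).
Qed.

(** Only the end triangles at notched ends can have three inner sides; these are the triangles where
    a diagonal may lack an exterior angle. *)
Lemma boundary_tri (t : tri P) :
  (exists2 e, notched e & t = strip gamma nq np (end_tri e)) \/
  exists2 s : side P, s.1 = t & boundary s.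
Proof.
case: (tri_cases t) => [[i ->]|[e [c [h1 h2 ->]]]]; last first.
  by right; exists (next (fan_corner e c)) => //; exact: fan_outer_boundary.
case: (strip_cases i) => [[e ->]|[j [l [h ->]]]].
  have [hn|hn] := boolP (notched e); first by left; exists e.
  right; exists (next (opposite_end e)); last by case: (end_boundary hn).
  exact: opposite_end_tri.
by right; case: (middle_corners h) => -[_ hb]; eexists; try exact: hb.
Qed.

Lemma inner_tri (t : tri P) : exists i, inner (G := P) (t, i).
Proof.
case: (tri_cases t) => [[i ->]|[e [c [h1 h2 ->]]]]; last first.
  by exists c.2; exact: inner_fan.
case: (strip_cases i) => [[e ->]|[j [l [h ->]]]].
  exists (opposite_end e).2; rewrite -opposite_end_tri -surjective_pairing.
  exact/inner_crosses/crosses_opposite_end.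
by exists (strip_enter l).2; apply: inner_crosses; right; exists l.
Qed.

(** * The hubs, which are the angles of the end triangles at the punctures *)

Definition hubs : {set corner P} :=
  [set fan_corner e (end_at e) | e : bool & notched e].

Lemma hubsP h : reflect (exists2 e, notched e & h = fan_corner e (end_at e))
  (h \in hubs).
Proof.
by apply: (iffP imsetP) => -[e h1 h2]; exists e => //; move: h1; rewrite ?inE.
Qed.

Lemma hub_tri (t : tri P) : (forall i, inner (G := P) (t, i)) ->
  exists2 h, h \in hubs & h.1 = t.
Proof.
move=> ht; case: (boundary_tri t) => [[e he ->]|[[t' z] /= e]].
  by exists (fan_corner e (end_at e)); [apply/hubsP; exists e|exact: around_end].
by rewrite e /boundary ht.
Qed.

Lemma hub_inner h i : h \in hubs -> inner (G := P) (h.1, i).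
Proof.
case/hubsP=> e he ->; have hc := in_fan_end he.
case: (@corner_cases P (fan_corner e (end_at e)) (around e (end_at e), i)) => // ->.
- exact: inner_fan.
- rewrite fan_corner_end prevK; exact/inner_crosses/crosses_opposite_end.
- exact: inner_prev_fan.
Qed.

Lemma hub_uniq h h' : h \in hubs -> h' \in hubs -> h.1 = h'.1 -> h = h'.
Proof.
case/hubsP=> e he -> /hubsP[e' he' ->].
by case/(fan_corner_inj (in_fan_end he) (in_fan_end he')) => ->.
Qed.

Lemma vertex_fan_corner e c : in_fan e c ->
  vertex (fan_corner e c) = vertex (fan_corner e (end_at e)).
Proof.
move=> /andP[hn hc].
have h n : vertex (fan_corner e (iter n turn (end_at e))) =
    vertex (fan_corner e (end_at e)).
  elim: n => //= n <-; apply: (@ccw_vertex P); apply: glued_fan.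
  by rewrite /in_fan hn /=; apply: iter_turn_vertex => //; exact: end_puncture.
move: hc; rewrite vertex_orbit //; first by move/iter_findex => <-.
exact: end_puncture.
Qed.

Lemma fan_vertexP e c s : in_fan e c ->
  reflect (exists2 c', in_fan e c' & s = fan_corner e c')
          (s \in vertex (fan_corner e c)).
Proof.
move=> hc; apply: (iffP idP) => [hs|[c' h1 ->]]; last first.
  by rewrite in_vertex !vertex_fan_corner.
pose Q (s : corner P) := [exists c', in_fan e c' && (s == fan_corner e c')].
suff : Q s by case/existsP=> c' /andP[h1 /eqP ->]; exists c'.
apply: (@vertex_closed P Q _ _ _ hs); last first.
  by apply/existsP; exists c; rewrite hc eqxx.
move=> a b hab; apply/existsP/existsP => -[c' /andP[h1 /eqP e1]].
  exists (turn c'); rewrite in_fan_turn //=; apply/eqP.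
  by apply: (polygon_glue_inj hab); rewrite e1; exact: glued_fan.
have [c1 h2 e2] := in_fan_turn_inv h1.
exists c1; rewrite h2 /=; apply/eqP/(@turn_inj P polygon_glueC polygon_glue_inj).
rewrite (ccw_turn polygon_glue_inj hab) e1 -e2; symmetry.
exact: (ccw_turn polygon_glue_inj (glued_fan h2)).
Qed.

Lemma puncture_fan e c : in_fan e c -> puncture (vertex (fan_corner e c)).
Proof.
move=> hc; rewrite /puncture mem_vertices; apply/forall_inP=> s.
by case/(fan_vertexP _ hc) => c' h ->; rewrite inner_fan ?inner_prev_fan.
Qed.

Lemma hub_puncture h : h \in hubs -> puncture (vertex h).
Proof. by case/hubsP=> e he ->; apply/puncture_fan/in_fan_end. Qed.

Lemma hub_vertex h h' : h \in hubs -> h' \in hubs ->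
  vertex h = vertex h' -> h = h'.
Proof.
case/hubsP=> e he -> /hubsP[e' he' ->] /eqP; rewrite -in_vertex.
case/(fan_vertexP _ (in_fan_end he')) => c hc /(congr1 fst) ec.
by have [-> _] := fan_corner_inj (in_fan_end he) hc ec.
Qed.

(* The boundary of the polygon is connected, and every vertex that is not the
   hub of a fan lies on it. *)
Section Constant.
Variable f : corner P -> bool.
Hypothesis f_ccw : forall a b : corner P, ccw a b -> f a = f b.
Hypothesis f_boundary : forall s : side P, boundary s -> f s = f (next s).

Let f_glued s s' : glued (g := P) s s' -> f (next s) = f s' /\ f s = f (next s').
Proof.
move=> h; split; first by apply: f_ccw; rewrite /ccw nextK.
by apply/esym/f_ccw; rewrite /ccw nextK polygon_glueC.
Qed.

Lemma constant_fan e c : in_fan e c ->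
  f (next (fan_corner e c)) = f (opposite_end e) /\
  f (prev (fan_corner e c)) = f (opposite_end e).
Proof.
move=> hc; have /andP[hn _] := hc.
have hp c' : in_fan e c' ->
    f (prev (fan_corner e c')) = f (next (fan_corner e (turn c'))).
  by move=> /glued_fan /f_glued[].
have hh c' : in_fan e c' -> f (next (fan_corner e c')) = f (opposite_end e).
  case/andP=> _ h; have -> : opposite_end e = next (fan_corner e (end_at e)).
    by rewrite fan_corner_end prevK.
  pose g c := f (next (fan_corner e c)).
  (* The outer sides of the fan are boundary sides except in the end triangle, where the outer side
     is tau_1 or tau_n; this is the one step that [fan_constant] supplies. *)
  apply: (fan_constant glueC glue_inj (end_puncture hn) (h := g)) => // c1 h1 h2.
  have hc1 : in_fan e c1 by rewrite /in_fan hn.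
  by rewrite /g -hp // f_boundary ?next_next //; exact: fan_outer_boundary.
by split; [exact: hh|rewrite hp // hh //; exact: in_fan_turn].
Qed.

Lemma constant_end e : f (next (opposite_end e)) = f (opposite_end e) /\
  (notched e \/ f (prev (opposite_end e)) = f (opposite_end e)).
Proof.
have [hn|hn] := boolP (notched e).
  split; last by left.
  have [_] := constant_fan (in_fan_end hn).
  by rewrite fan_corner_end prev_prev.
have [h1 h2] := end_boundary hn.
have e2 : f (prev (opposite_end e)) = f (opposite_end e).
  by rewrite (f_boundary h2) prevK.
by split; [rewrite (f_boundary h1) next_next|right].
Qed.

Let a := f (strip_leave ord0).

Lemma constant_middle i j : lift ord_max j = lift ord0 i :> 'I_k.+2 ->
  f (strip_enter i) = a -> f (next (strip_enter i)) = a ->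
  forall s, s.1 = (strip_enter i).1 -> f s = a.
Proof.
move=> hij h1 h2 s; have h3 : f (prev (strip_enter i)) = a.
  case: (middle_corners hij) => -[_ hb].
    by rewrite (f_boundary hb) prevK.
  by rewrite -h2 (f_boundary hb) next_next.
by case/(@corner_cases P) => ->.
Qed.

(** Induction along the strip: both ends of a crossed side carry the value into the next triangle,
    whose third vertex is joined to one of them by a boundary side. *)
Lemma constant_leave i : f (strip_leave i) = a /\ f (next (strip_leave i)) = a.
Proof.
case: i => n; elim: n => [|n ih] hn.
  have -> : Ordinal hn = ord0 by apply: val_inj.
  by split=> //; case: (constant_end false).
have hn' : (n < k.+1)%N by apply: ltnW.
have [h1 h2] := ih hn'; have [h3 h4] := f_glued (glued_strip (Ordinal hn')).
have hij : lift ord_max (Ordinal hn) = lift ord0 (Ordinal hn') :> 'I_k.+2.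
  by apply: ord_inj; rewrite lift_max lift0.
have hs := constant_middle hij (etrans (esym h3) h2) (etrans (esym h4) h1).
by split; apply: hs; rewrite /= hij.
Qed.

Lemma constant_enter i : f (strip_enter i) = a /\ f (next (strip_enter i)) = a.
Proof.
have [h1 h2] := constant_leave i; have [h3 h4] := f_glued (glued_strip i).
by rewrite -h3 -h4.
Qed.

Lemma constant_opposite e : f (opposite_end e) = a.
Proof. by case: e => //=; case: (constant_enter ord_max). Qed.

Lemma constant_corner s :
  (forall e c, in_fan e c -> s <> fan_corner e c) -> f s = a.
Proof.
move=> hs; case: (tri_cases s.1) => [[i ei]|[e [c [hc _ ec]]]]; last first.
  have [h1 h2] := constant_fan hc.
  case: (@corner_cases P (fan_corner e c) s) => // es.
  - by case: (hs e c).
  - by rewrite es h1 constant_opposite.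
  - by rewrite es h2 constant_opposite.
case: (strip_cases i) => [[e ee]|[j [l [hij el]]]]; last first.
  have [h1 h2] := constant_enter l; apply: (constant_middle hij h1 h2).
  by rewrite ei el.
have e1 : s.1 = (opposite_end e).1 by rewrite opposite_end_tri ei ee.
have [h1 h2] := constant_end e; rewrite -(constant_opposite e).
case: (@corner_cases P _ _ e1) => es; rewrite es //.
case: h2 => // hn; case: (hs e (end_at e)); first exact: in_fan_end.
by rewrite fan_corner_end.
Qed.

End Constant.

Lemma boundary_not_fan s e c : boundary s -> in_fan e c -> s <> fan_corner e c.
Proof. by move=> hb hc es; move: hb; rewrite es /boundary inner_fan. Qed.

Lemma exists_boundary : exists s : side P, boundary s.
Proof.
have [hn|hn] := boolP (notched false); last first.
  by case: (end_boundary hn) => h _; eexists; exact: h.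
(* By [end_turn] the fan has a triangle besides the end triangle, and its outer side is on the
   boundary. *)
exists (next (fan_corner false (turn (end_at false)))).
apply: fan_outer_boundary; last exact: end_turn.
exact/in_fan_turn/in_fan_end.
Qed.

(** Being at a puncture is constant on vertices and false at both ends of every boundary side. By
    connectedness of the boundary it is false at every corner that is not a fan corner. *)
Lemma puncture_hub c : puncture (vertex c) ->
  exists2 h, h \in hubs & vertex h = vertex c.
Proof.
move=> hp.
pose Q := [exists e, [exists c', in_fan e c' && (c == fan_corner e c')]].
have [/existsP[e /existsP[c' /andP[hc /eqP->]]]|hQ] := boolP Q.
  exists (fan_corner e (end_at e)); last by rewrite vertex_fan_corner.
  by apply/hubsP; exists e => //; case/andP: hc.
pose f (c : corner P) := puncture (vertex c).
have fc a b : ccw a b -> f a = f b by move/ccw_vertex => h; rewrite /f h.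
have fb s : boundary (G := P) s -> f s = false.
  by move=> hs; apply: contraNF hs => /puncture_inner /andP[].
have fb' s : boundary (G := P) s -> f s = f (next s).
  move=> hs; rewrite fb //; apply/esym/negP=> /puncture_inner /andP[_].
  by rewrite nextK => h; move: hs; rewrite /boundary h.
have [s hs] := exists_boundary.
have h1 := constant_corner fc fb' (fun e c => @boundary_not_fan s e c hs).
have : f c = f s.
  rewrite h1; apply: constant_corner => // e c' hc ec; case/negP: hQ.
  by apply/existsP; exists e; apply/existsP; exists c'; rewrite hc ec eqxx.
by rewrite (fb s) // /f hp.
Qed.

(* The labels below are constant on vertices and separate the three vertices of
   each triangle.  The triangles of the strip introduce one new vertex each; the
   outer vertices of a fan are told apart by their position around the puncture. *)
Fixpoint strip_label (n : nat) (z : 'Z_3) : nat :=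
  if n is n'.+1 then
    if z == (enter gamma (inord n')).2
    then strip_label n' ((leave gamma (inord n')).2 + 1)
    else if z == (enter gamma (inord n')).2 + 1
    then strip_label n' (leave gamma (inord n')).2 else n'.+3
  else if z == (leave gamma ord0).2 then 1%N
  else if z == (leave gamma ord0).2 + 1 then 2%N else 0%N.

Lemma strip_label_lt n z : (strip_label n z < n.+3)%N.
Proof.
elim: n z => [|n ih] z /=; first by case: ifP => // _; case: ifP.
by do 2 (case: ifP => _; first by rewrite leqW ?ih).
Qed.

Lemma strip_label_inj n : injective (strip_label n).
Proof.
elim: n => [|n ih] z z' /=.
  set y := (leave gamma ord0).2.
  have e1 : (y - 1 == y + 1) = false by rewrite eq_sym Z3_addr1_subr1_neq.
  by case: (Z3_cases y z) => ->; case: (Z3_cases y z') => ->;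
    rewrite ?eqxx ?Z3_addr1_neq ?Z3_subr1_neq ?e1 ?eqxx.
set y := (enter _ _).2; set w := (leave _ _).2.
have h1 : strip_label n (w + 1) <> strip_label n w.
  by move/ih/eqP; rewrite Z3_addr1_neq.
have h2 : strip_label n (w + 1) <> n.+3.
  by move=> e; have := strip_label_lt n (w + 1); rewrite e ltnn.
have h3 : strip_label n w <> n.+3.
  by move=> e; have := strip_label_lt n w; rewrite e ltnn.
have e1 : (y - 1 == y + 1) = false by rewrite eq_sym Z3_addr1_subr1_neq.
by case: (Z3_cases y z) => ->; case: (Z3_cases y z') => ->;
  rewrite ?eqxx ?Z3_addr1_neq ?Z3_subr1_neq ?e1 ?eqxx // => e;
  first [case: (h1 e) | case: (h2 e) | case: (h3 e) | case: (h1 (esym e))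
        | case: (h2 (esym e)) | case: (h3 (esym e))].
Qed.

Definition end_label e z := strip_label (end_tri e) z.

(** This labels the vertex at [next (fan_corner e c)]. Positions 0 and 1 are the two ends of the
    side opposite to the puncture, already labelled by the strip; strip labels are below [k.+4], the
    first free value. The two fans may share labels, since only vertices of one triangle have to be
    separated. *)
Definition outer_label e c : nat :=
  match fan_position (end_at e) c with
  | 0 => end_label e ((end_at e).2 + 1)
  | 1 => end_label e ((end_at e).2 - 1)
  | j.+2 => (k.+4 + j)%N
  end.

Definition fan_label e (c : corner S) (z : 'Z_3) : nat :=
  if z == c.2 then end_label e (end_at e).2
  else if z == c.2 + 1 then outer_label e c else outer_label e (turn c).

Definition label (s : corner P) : nat :=
  match s.1 with
  | inl (inl i) => strip_label i s.2
  | inl (inr u) => fan_label false (val u) s.2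
  | inr u => fan_label true (val u) s.2
  end.

Lemma label_around e c z : in_fan e c -> label (around e c, z) = fan_label e c z.
Proof.
move=> hc; have [->|hne] := eqVneq c (end_at e); last first.
  by case: e hc hne => hc hne; have [u eu ec] := aroundP hc hne;
    rewrite eu /label /= ec.
have hn : notched e by case/andP: hc.
rewrite around_end /label /= /fan_label /outer_label fan_position0 //.
rewrite fan_position1 //; last exact: end_turn.
by case: (Z3_cases (end_at e).2 z) => ->;
  rewrite ?eqxx ?Z3_addr1_neq ?Z3_subr1_neq // eq_sym Z3_addr1_subr1_neq.
Qed.

Lemma label_seam (s s' : side P) : seamed s s' ->
  label (next s) = label s' /\ label s = label (next s').
Proof.
case/seamP=> [[i [-> ->]]|[e [c [hc -> ->]]]].
  have e1 z : label (strip gamma nq np (lift ord_max i), z) = strip_label i z.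
    by rewrite -[label _]/(strip_label (lift ord_max i) z) lift_max.
  have e2 z : label (strip gamma nq np (lift ord0 i), z) = strip_label i.+1 z.
    by rewrite -[label _]/(strip_label (lift ord0 i) z) lift0.
  by rewrite /next /= !e1 !e2 /= inord_val eqxx Z3_addr1_neq eqxx.
have hc' := in_fan_turn hc.
rewrite prevK /fan_corner /next /prev /= !label_around // /fan_label.
by rewrite !eqxx Z3_subr1_neq (eq_sym (c.2 - 1)) Z3_addr1_subr1_neq Z3_addr1_neq.
Qed.

Lemma label_ccw a b : ccw (G := P) a b -> label a = label b.
Proof.
rewrite /ccw => /glued_polygonP[] /label_seam[h1 h2].
  by rewrite -h1 prevK.
by rewrite h2 prevK.
Qed.

Lemma outer_label_inj e c c' : in_fan e c -> in_fan e c' ->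
  outer_label e c = outer_label e c' -> c = c'.
Proof.
move=> /andP[hn hc] /andP[_ hc'] h.
have hp := end_puncture hn.
apply: (fan_position_inj glueC glue_inj hp hc hc').
have lt z : (end_label e z < k.+4)%N.
  apply: leq_trans (strip_label_lt _ _) _; rewrite !ltnS.
  by case: (e).
have h0 z j : end_label e z <> (k.+4 + j)%N.
  by move=> ez; have := lt z; rewrite ez ltnNge leq_addr.
have h1 : end_label e ((end_at e).2 + 1) <> end_label e ((end_at e).2 - 1).
  by move/strip_label_inj/eqP; rewrite Z3_addr1_subr1_neq.
move: h; rewrite /outer_label.
case: (fan_position _ c) => [|[|j]]; case: (fan_position _ c') => [|[|j']] // ez;
  first [by case: (h1 ez) | by case: (h1 (esym ez)) | by case: (h0 _ _ ez)
        | by case: (h0 _ _ (esym ez)) | by move/addnI: ez => ->].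
Qed.

Lemma outer_label_end e c : outer_label e c <> end_label e (end_at e).2.
Proof.
rewrite /outer_label; case: (fan_position _ c) => [|[|j]].
- by move/strip_label_inj/eqP; rewrite Z3_addr1_neq.
- by move/strip_label_inj/eqP; rewrite Z3_subr1_neq.
- move=> ez; have := strip_label_lt (end_tri e) (end_at e).2.
  rewrite -/(end_label e _) -ez ltnNge => /negP; apply.
  by apply: leq_trans (leq_addr _ _); case: (e).
Qed.

(** A fixed point would be the whole orbit, hence equal to the end corner, against [end_turn]. *)
Lemma turn_neq e c : in_fan e c -> turn c <> c.
Proof.
move=> /andP[hn hc] h; have hp := end_puncture hn.
have hi n : iter n turn c = c by elim: n => //= n ->.
move: (hc); rewrite vertex_orbit // fconnect_sym; last exact: turn_inj.
move/iter_findex; rewrite hi => ec.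
by have := end_turn hn; rewrite -ec h eqxx.
Qed.

Lemma label_inj t z z' : label (t, z) = label (t, z') -> z = z'.
Proof.
case: (tri_cases t) => [[i ->]|[e [c [hc _ ->]]]]; first exact: strip_label_inj.
have hc' := in_fan_turn hc.
rewrite !label_around // /fan_label.
have h1 : outer_label e c <> outer_label e (turn c).
  by move/(outer_label_inj hc hc')/esym; exact: turn_neq hc.
have h2 := @outer_label_end e c; have h3 := @outer_label_end e (turn c).
have e1 : (c.2 - 1 == c.2 + 1) = false by rewrite eq_sym Z3_addr1_subr1_neq.
by case: (Z3_cases c.2 z) => ->; case: (Z3_cases c.2 z') => ->;
  rewrite ?eqxx ?Z3_addr1_neq ?Z3_subr1_neq ?e1 ?eqxx // => ez;
  first [case: (h1 ez) | case: (h2 ez) | case: (h3 ez) | case: (h1 (esym ez))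
        | case: (h2 (esym ez)) | case: (h3 (esym ez))].
Qed.

Lemma polygon_vertex_inj (c c' : corner P) :
  c.1 = c'.1 -> vertex c = vertex c' -> c = c'.
Proof.
move=> h1 h2; have h : c' \in vertex c by rewrite in_vertex h2.
have := vertex_const label_ccw h.
by case: c c' h1 {h2 h} => t z [t' z'] /= -> /label_inj ->.
Qed.

(** The potentials [r] of the triangles are corrected by one constant [a] per triangle so as to
    agree across all seams; evenness at the boundary vertices then makes the result constant on the
    boundary. *)
Lemma polygon_potential (D : corner P -> bool) :
  (forall t, \big[addb/false]_(c | c.1 == t) D c = false) ->
  (forall v, v \in vertices P -> \big[addb/false]_(c in v) D c = false) ->
  exists x : side P -> bool,
    [/\ forall s s', glued s s' -> x s = x s',
        forall s, boundary s -> x s = false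
      & forall c, D c = x c (+) x (prev c)].
Proof.
move=> htri hvert; have [r hr] := tri_potential htri.
(* The corrections along the strip accumulate the jumps of [r] across the crossed sides. *)
pose sa := fix sa n := if n is n'.+1 then
  sa n' (+) (r (strip_leave (inord n')) (+) r (strip_enter (inord n'))) else false.
have fa e : exists a : corner S -> bool, notched e ->
    a (end_at e) = sa (end_tri e) /\
    forall c, in_fan e c ->
      a c (+) a (turn c) = r (prev (fan_corner e c)) (+) r (fan_corner e (turn c)).
  have [hn|_] := boolP (notched e); last by exists xpred0.
  have hp := end_puncture hn.
  pose g c := r (prev (fan_corner e c)) (+) r (fan_corner e (turn c)).
  (* The jumps around the puncture, regrouped by triangle instead of by seam, add up to the sum of
     [D] over the hub vertex, which vanishes. *)
  have hg : \big[addb/false]_(c in vertex (end_at e)) g c = false.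
    rewrite /g big_split /=.
    rewrite (xor_turn glueC glue_inj hp (fun c => r (fan_corner e c))).
    rewrite -big_split /= -[RHS](hvert _ (mem_vertices (fan_corner e (end_at e)))).
    have -> : vertex (fan_corner e (end_at e)) =
        [set fan_corner e c | c in vertex (end_at e)].
      apply/setP=> s; apply/(fan_vertexP _ (in_fan_end hn))/imsetP => -[c hc ->].
        by exists c => //; case/andP: hc.
      by exists c => //; rewrite /in_fan hn.
    rewrite big_imset /=; first by apply: eq_bigr => c _; rewrite hr addbC.
    move=> c c' hc hc' /(congr1 fst) /(@around_inj e e c c') [] //;
      by rewrite /in_fan hn.
  case: (fan_potential glueC glue_inj hp (sa (end_tri e)) hg) => a h1 h2.
  by exists a => _; split=> // c /andP[_ hc]; exact: h2.
case: (fa false) => aq hq; case: (fa true) => ap hpp.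
pose a (t : tri P) := match t with
  | inl (inl i) => sa i | inl (inr u) => aq (val u) | inr u => ap (val u) end.
have a_fan e c : in_fan e c -> a (around e c) = (if e then ap else aq) c.
  move=> hc; have [hn _] := andP hc; have [->|hne] := eqVneq c (end_at e).
    rewrite around_end /=; apply/esym.
    by case: e hc hn => _ hn; [case: (hpp hn)|case: (hq hn)].
  by case: e hc hne {hn} => hc hne; have [u eu ec] := aroundP hc hne;
    rewrite eu -[in RHS]ec.
pose x s := r s (+) a s.1.
have x_seam s s' : seamed s s' -> x s = x s'.
  case/seamP=> [[i [-> ->]]|[e [c [hc -> ->]]]].
    have -> : x (strip_leave i) = r (strip_leave i) (+) sa (lift ord_max i) by [].
    have -> : x (strip_enter i) = r (strip_enter i) (+) sa (lift ord0 i) by [].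
    rewrite lift_max lift0 /= inord_val.
    by move: (sa _) (r _) (r _) => [] [] [].
  rewrite /x /= !a_fan // ?in_fan_turn //.
  have : (if e then ap else aq) c (+) (if e then ap else aq) (turn c) =
      r (prev (fan_corner e c)) (+) r (fan_corner e (turn c)).
    have [hn _] := andP hc.
    by case: e hc hn => hc hn; [case: (hpp hn)|case: (hq hn)] => _; apply.
  have addb_exchange (b1 b2 b3 b4 : bool) :
    b3 (+) b4 = b1 (+) b2 -> b1 (+) b3 = b2 (+) b4.
    by case: b1 b2 b3 b4 => [] [] [] [].
  exact: addb_exchange.
have x_glued s s' : glued (g := P) s s' -> x s = x s'.
  by case/glued_polygonP=> /x_seam.
have x_diff c : D c = x c (+) x (prev c).
  by rewrite hr /x /= addbACA addbb addbF.
(* Moving [x] from boundary sides to vertices makes [constant_corner] applicable. *)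
pose f := boundary_value x.
have fb s : boundary (G := P) s -> f s = f (next s).
  move=> hs; rewrite /f (boundary_valueE polygon_glueC polygon_glue_inj) //.
  rewrite (boundary_value_next polygon_glueC polygon_glue_inj x_glued) //.
  rewrite -[RHS](hvert _ (mem_vertices (next s))).
  by apply: eq_bigr => c _.
exists (fun s => x s (+) f (strip_leave ord0)); split.
- by move=> s s' /x_glued ->.
- move=> s hs; rewrite -(boundary_valueE polygon_glueC polygon_glue_inj x hs).
  have -> : boundary_value x s = f (strip_leave ord0); last exact: addbb.
  apply: (@constant_corner f _ fb) => [a1 b1|e c]; first exact: boundary_value_ccw.
  exact: boundary_not_fan.
- by move=> c; rewrite addbACA addbb addbF.
Qed.

(** * The exceptional diagonal and the special angles *)

Lemma turn_end_preimage e : notched e -> exists c,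
  [/\ in_fan e c, c != end_at e & turn c = end_at e].
Proof.
move=> /in_fan_end /in_fan_turn_inv[c hc ec]; exists c; split=> //.
by apply/eqP=> e1; apply: (turn_neq hc); rewrite ec e1.
Qed.

Lemma edge_glued_polygon (s s' : side P) : glued s s' -> edge s' = edge s.
Proof. exact: (edge_glued polygon_glueC polygon_glue_inj). Qed.

Lemma tau1E : tau1 gamma nq np = edge (strip_leave ord0).
Proof.
by rewrite /tau1 /strip_leave; congr (@edge P (strip gamma nq np _, _));
  apply: ord_inj; rewrite lift_max.
Qed.

Lemma last_sideE (s : side P) :
  (edge s == zeta_last gamma nq np) || (edge s == xi_last gamma nq np) =
  [exists e, edge s == edge (fan_corner e (end_at e))].
Proof.
have hz : zeta_last gamma nq np = edge (fan_corner true (end_at true)).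
  by rewrite /fan_corner around_end.
have hx : xi_last gamma nq np = edge (fan_corner false (end_at false)).
  by rewrite /fan_corner around_end.
rewrite hz hx; apply/orP/existsP => [[h|h]|[[] h]].
- by exists true.
- by exists false.
- by left.
- by right.
Qed.

Lemma special_angleE (c : corner P) : special_angle c =
  ([exists e, edge c == edge (fan_corner e (end_at e))] &&
    ((edge (prev c) == tau1 gamma nq np) || boundary (prev c))) ||
  ([exists e, edge (prev c) == edge (fan_corner e (end_at e))] &&
    ((edge c == tau1 gamma nq np) || boundary c)).
Proof. by congr ((_ && _) || (_ && _)); exact: last_sideE. Qed.

(** Without an exterior angle, both triangles at [d] are notched end triangles. If [d] is a crossed
    side, this crossing is both the first and the last one, so [k] is 0; a fan seam would join the
    end corner to itself, against [turn_neq]. *)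
Lemma diagonal_exterior d : d \in diagonals P -> has_exterior (G := P) d \/
  [/\ nq, np, k = 0%N & d = tau1 gamma nq np].
Proof.
move=> hd.
have side_exterior (s : side P) : inner s -> d = edge s ->
    has_exterior (G := P) d \/
    exists2 e, notched e & s.1 = strip gamma nq np (end_tri e).
  move=> hs ->; case: (boundary_tri s.1) => [|[s2 h1 hb]]; first by right.
  left; case/(@corner_cases P): h1 => es.
  - by move: hb; rewrite es /boundary hs.
  - exists (next s); last by right; rewrite nextK.
    by rewrite /exterior nextK -es hb /boundary hs.
  - exists s; last by left.
    by rewrite /exterior -es hb /boundary hs.
have glued_exterior (s s' : side P) : glued s s' -> d = edge s ->
    has_exterior (G := P) d \/
    (exists2 e, notched e & s.1 = strip gamma nq np (end_tri e)) /\
    (exists2 e, notched e & s'.1 = strip gamma nq np (end_tri e)).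
  move=> h es; case: (side_exterior s) => //; [exact: (glued_inner h)|by left|].
  move=> h1; case: (side_exterior s').
  - exact: (@glued_innerr P polygon_glueC _ _ h).
  - by rewrite (edge_glued_polygon h).
  - by left.
  - by right.
have [s hs es] := diagonalP _ hd.
have [s1 [s2 [h12 e1]]] : exists s1 s2 : side P, seamed s1 s2 /\ d = edge s1.
  case/existsP: hs => s' /orP[] h; first by exists s, s'.
  exists s', s; split=> //; rewrite es; apply: edge_glued_polygon.
  by apply/glued_polygonP; left.
have g12 : glued (g := P) s1 s2 by apply/glued_polygonP; left.
case: (glued_exterior s1 s2) => // [h|[[e he h1] [e' he' h2]]]; first by left.
case/seamP: h12 => [[i [E1 E2]]|[e3 [c [hc E1 E2]]]].
  rewrite E1 in h1; rewrite E2 in h2.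
  have hh1 := strip_inj h1; have hh2 := strip_inj h2.
  have o1 := strip_leave_tri hh1; have o2 := strip_enter_tri hh2.
  right; case: e he h1 hh1 o1 => he h1 hh1 o1.
    by case: (strip_enter_leave (esym o1)).
  case: e' he' h2 hh2 o2 => he' h2 hh2 o2; last first.
    by case: (strip_enter_leave o2).
  split=> //; last by rewrite tau1E -[strip_leave ord0]o1 -E1.
  have := etrans (esym (strip_leave_inj o1)) (strip_enter_inj o2).
  by move/(congr1 (@nat_of_ord _)).
have a1 : around e3 c = strip gamma nq np (end_tri e) by rewrite -h1 E1.
have a2 : around e3 (turn c) = strip gamma nq np (end_tri e') by rewrite -h2 E2.
have [c1 _] := around_strip hc a1.
have [c2 _] := around_strip (in_fan_turn hc) a2.
by case: (turn_neq hc); rewrite c2 c1.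
Qed.

Section Matching.
Variable E : {set graph_edge P}.
Hypothesis hE : perfect_matching E.

Let hmin : is_minimal (minimal_matching P).
Proof.
exact: (minimal_matchingP polygon_glueC polygon_glue_inj inner_tri hub_tri
  hub_inner hub_uniq hub_puncture hub_vertex puncture_hub).
Qed.

Let hblack c : c \in minimal_matching P -> vertex c \in black P.
Proof. exact: (minimal_black polygon_glueC polygon_glue_inj inner_tri). Qed.

Let X := bounded_squares E.

Lemma I_Y : I_ E = Y (varpi_inv E).
Proof.
have [x [x_glued x_boundary x_diff]] := polygon_potential
  (xor_difference_tri polygon_vertex_inj hE hmin)
  (xor_difference_vertex polygon_vertex_inj hE hmin hblack).
have hY := Y'P polygon_glueC polygon_glue_inj polygon_vertex_inj hE hblack
  x_glued x_boundary x_diff.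
have hXI := bounded_squares_I polygon_glueC polygon_glue_inj polygon_vertex_inj
  hE hblack x_glued x_boundary x_diff.
have hIX := I_bounded_squares polygon_glueC polygon_glue_inj polygon_vertex_inj
  hE hblack x_glued x_boundary x_diff.
have hS := second_last_bounded_squares polygon_glueC polygon_glue_inj
  polygon_vertex_inj hE hmin hblack x_glued x_boundary x_diff.
have hSI := second_last_I polygon_glueC polygon_glue_inj
  polygon_vertex_inj hE hmin hblack x_glued x_boundary x_diff.
have exterior_case d : d \in diagonals P -> has_exterior (G := P) d ->
    (d \in I_ E) = (d \in Y' (varpi_inv E)).
  move=> hd he; apply/idP/idP => [/(hIX d he) h|/hY[_ h _]]; last exact: hXI.
  exact/hY.
have tau1_case : nq -> np -> k = 0%N ->
    (tau1 gamma nq np \in X) =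
      [exists c in varpi_inv E, special_angle c] /\
    (tau1 gamma nq np \in I_ E -> tau1 gamma nq np \in X).
  move=> hq hp hk.
  have hn e : notched e by case: e.
  have o0 : ord_max = ord0 :> 'I_k.+1 by apply: ord_inj; rewrite /= hk.
  (* With one crossing, the two values of [opposite_end] are the two sides of tau_1, and their
     starting points are its two endpoints. *)
  have hopp e : edge (opposite_end e) = tau1 gamma nq np.
    rewrite tau1E; case: e => //=; rewrite o0.
    exact: edge_glued_polygon (glued_strip ord0).
  have htau (s : side P) : edge s = tau1 gamma nq np -> crosses s.
    move=> es; have : s \in tau1 gamma nq np by rewrite -es edge_refl.
    rewrite tau1E in_edge => /predU1P[->|h]; first by left; exists ord0.
    by right; exists ord0; apply: polygon_glue_inj h (glued_strip ord0).
  (* The last two angles at an endpoint of tau_1 are f = [opposite_end e] and f' =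
     [prev (fan_corner e c)], where [c] precedes the end corner around the puncture. *)
  have hf e : exists c, [/\ in_fan e c, c != end_at e,
      glued (prev (opposite_end e)) (prev (fan_corner e c)),
      boundary (prev (prev (fan_corner e c))) & inner (opposite_end e)].
    have [c [hc hne ec]] := turn_end_preimage (hn e).
    exists c; split=> //.
    - by rewrite -fan_corner_end -ec polygon_glueC; exact: glued_fan.
    - by rewrite prev_prev; exact: fan_outer_boundary.
    - exact/inner_crosses/crosses_opposite_end.
  split; last first.
    have [c [_ _ h1 h2 h3]] := hf false.
    by rewrite -(hopp false) => /(hSI _ _ h3 h1 h2).
  apply/idP/exists_inP.
    have [c [_ _ h1 h2 h3]] := hf false.
    rewrite -(hopp false) (hS _ _ h3 h1 h2) => /orP[] hA.
      exists (opposite_end false); first exact: hA.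
      rewrite special_angleE.
      apply/orP; right; rewrite hopp eqxx andbT.
      by apply/existsP; exists false; rewrite fan_corner_end.
    exists (prev (fan_corner false c)); first exact: hA.
    rewrite special_angleE.
    apply/orP; left; rewrite h2 orbT andbT.
    by apply/existsP; exists false; rewrite fan_corner_end (edge_glued_polygon h1).
  case=> c hA hc.
  (* The special angles are f and f' at the two endpoints, and either endpoint decides whether tau_1
     is in [X]. *)
  suff [e he] : exists e, c = opposite_end e \/
      glued (prev (opposite_end e)) c.
    have [c1 [_ _ h1 h2 h3]] := hf e.
    rewrite -(hopp e) (hS _ _ h3 h1 h2); case: he => [<-|h]; first by rewrite hA.
    by rewrite (polygon_glue_inj h1 h) hA orbT.
  have last_side (s : side P) :
    [exists e, edge s == edge (fan_corner e (end_at e))] ->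
      exists e, s = prev (opposite_end e) \/ glued (prev (opposite_end e)) s.
    case/existsP=> e /eqP es; exists e; have := edge_refl s.
    by rewrite es fan_corner_end in_edge => /predU1P.
  (* Besides f and f', the angles at zeta_m or xi_l are those at the puncture; their other side is a
     fan diagonal, neither tau_1 nor a boundary side. *)
  move: hc; rewrite special_angleE => /orP[] /andP[/last_side[e he] hc].
    exists e; case: he => [ec|]; last by right.
    case/orP: hc => [/eqP/htau hc|].
      have := crosses_fan (in_fan_end (hn e)) hc.
      by rewrite ec -fan_corner_end => /(_ erefl) /esym /(@next_prev_neq P).
    by rewrite ec -fan_corner_end /boundary inner_prev_fan ?in_fan_end.
  exists e; case: he => [/(can_inj (@prevK P)) ->|h]; first by left.
  have [c1 [hc1 _ h1 _ _]] := hf e.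
  have ec : c = fan_corner e c1.
    by apply: (can_inj (@prevK P)); exact: polygon_glue_inj h h1.
  case/orP: hc => [/eqP/htau hc|].
    have := crosses_fan hc1 hc.
    by rewrite ec => /(_ erefl) /esym /(@next_neq P).
  by rewrite ec /boundary inner_fan.
apply/setP=> d; rewrite /Y; case: ifP => [/and4P[hq hp /eqP hk hA]|hn].
  have [hT _] := tau1_case hq hp hk.
  rewrite in_setU1; have [->|hne] := eqVneq d (tau1 gamma nq np).
    by apply: hXI; rewrite -/X hT.
  rewrite /=; have [hd|hd] := boolP (d \in diagonals P); last first.
    by rewrite !inE (negbTE hd).
  case: (diagonal_exterior hd) => [he|[_ _ _ e]]; first exact: exterior_case.
  by rewrite e eqxx in hne.
have [hd|hd] := boolP (d \in diagonals P); last by rewrite !inE (negbTE hd).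
case: (diagonal_exterior hd) => [he|[hq hp hk e]]; first exact: exterior_case.
have [hT hTI] := tau1_case hq hp hk.
have hX : (d \in X) = false.
  rewrite e hT; apply: contraFF hn => h.
  by apply/and4P; split=> //; apply/eqP.
apply/idP/idP => [|/hY[_]]; last by rewrite -/X hX.
by rewrite e => /hTI; rewrite -e hX.
Qed.

End Matching.
End Polygon.

Theorem proposition1p7 (S : gluing) (hS : triangulated_marked_surface S)
    (N : {set {set corner S}}) (hT : tagged_triangulation N)
    (hA1 : A1 (tagged_arcs N))
    (k : nat) (gamma : k.+1.-tuple (side S * side S)) (nq np : bool)
    (hdelta : tagged_arc gamma nq np)
    (hA2 : A2 (tagged_arcs N) gamma nq np)
    (E : {set graph_edge (polygon gamma nq np)})
    (hE : perfect_matching E) :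
  I_ E = Y (varpi_inv E).
Proof.
case: hS => glueC _ glue_inj _ _.
case: hdelta => -[hred _ _] [hq hp _ _].
have hpun e : notched nq np e -> puncture (vertex (end_at gamma e)) by case: e.
apply: (I_Y glueC glue_inj hred hpun) => // e he; apply/eqP=> h.
have hin : inner (prev (end_at gamma e)).
  by move/puncture_inner: (hpun e he) => /andP[].
(* A corner fixed by [turn] is the angle of a self-folded triangle at its enclosed puncture. There T
   contains the radius notched at that puncture: by (A1) it is 1-notched, and (A2) then forbids the
   arc to be notched there. *)
have hc : enclosed (end_at gamma e).
  by rewrite /enclosed -{2}h; exact: turn_ccw.
set a := (edge (end_at gamma e),
  end_at gamma e |: notched_ends N (edge (end_at gamma e))).
have ha : a \in tagged_arcs N.
  by rewrite in_setU; apply/orP; right; apply/imsetP; exists (end_at gamma e);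
    rewrite ?inE.
have hnot : notched_at a (vertex (end_at gamma e)).
  by apply/exists_inP; exists (end_at gamma e) => //=; rewrite setU11.
have h1 : one_notched a.
  case/orP: (proj1 hA1 a ha) => //; rewrite /plain cards_eq0 => /eqP h0.
  by have := setU11 (end_at gamma e) (notched_ends N (edge (end_at gamma e)));
    rewrite -[_ |: _]/(a.2) h0 inE.
have hA2_end e' : notched nq np e' -> ~~ notched_at a (vertex (end_at gamma e')).
  by case: (hA2 a ha h1) => h2 h3; case: e'.
by have := hA2_end e he; rewrite hnot.
Qed.
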